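(* Let $V\colon\mathbb{R}^2\to\mathbb{R}$ be continuous with $\inf_{\mathbb{R}^2}V>0$, and suppose its distributional derivatives are functions satisfying $|\nabla V(x)|\le CV^{3/2}(x)$ for a.e. $x\in\mathbb{R}^2$ and some constant $C>0$. Let $\{u_n\}_n$ be a bounded sequence in $H^1_V(\mathbb{R}^2)$ such that for some $r>0$, \[ \lim_{n\to+\infty}\sup_{\xi\in\mathbb{R}^2}\int_{B_r(\xi)}V(x)u_n^2\,dx=0 . \] Then $u_n\to0$ strongly in $L^\tau_V(\mathbb{R}^2)$ for every $\tau>2$.
   Context: $H^1_V(\mathbb{R}^2)$ is the completion of $C_0^\infty(\mathbb{R}^2)$ with respect to the norm $\|u\|_V=\left(\int_{\mathbb{R}^2}(|\nabla u|^2+V|u|^2)\,dx\right)^{1/2}$; $L^\tau_V(\mathbb{R}^2)$ is the space of measurable $u$ with $\int V|u|^\tau<\infty$, normed by $\left(\int V|u|^\tau\right)^{1/\tau}$. $B_r(\xi)$ is the open ball of radius $r$ centered at $\xi$. *)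

(* Defs.v *)
From HB Require Import structures.
From mathcomp Require Import all_boot all_order all_algebra.
From mathcomp Require Import all_classical all_reals all_analysis.
Set Implicit Arguments. Unset Strict Implicit. Unset Printing Implicit Defensive.
Import Order.TTheory GRing.Theory Num.Theory.
Import numFieldNormedType.Exports.
Local Open Scope classical_set_scope.
Local Open Scope ring_scope.

Section Defs.
Variable R : realType.

Definition pt := (R * R)%type.

Definition mu2 := ((@lebesgue_measure R) \x (@lebesgue_measure R))%E.

Definition dx (f : pt -> R^o) : pt -> R^o := 'D_((1, 0) : pt) f.
Definition dy (f : pt -> R^o) : pt -> R^o := 'D_((0, 1) : pt) f.

Fixpoint Ck (k : nat) (f : pt -> R^o) : Prop :=
  match k with
  | 0%N => continuous f
  | k'.+1 => (forall x, differentiable f x) /\ Ck k' (dx f) /\ Ck k' (dy f)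
  end.

Definition smooth (f : pt -> R^o) := forall k, Ck k f.

Definition test_fun (phi : pt -> R^o) :=
  smooth phi /\ exists M : R, forall x : pt, M < `|x.1| \/ M < `|x.2| -> phi x = 0.

Definition loc_int (f : pt -> R) :=
  measurable_fun setT f /\
  forall K : set pt, compact K -> mu2.-integrable K (EFin \o f).

Definition weak_grad (u g1 g2 : pt -> R) :=
  [/\ loc_int u, loc_int g1, loc_int g2 &
   forall phi, test_fun phi ->
     (\int[mu2]_x (u x * dx phi x)%:E = - \int[mu2]_x (g1 x * phi x)%:E)%E /\
     (\int[mu2]_x (u x * dy phi x)%:E = - \int[mu2]_x (g2 x * phi x)%:E)%E].

Definition normV2 (V u g1 g2 : pt -> R) : \bar R :=
  (\int[mu2]_x ((g1 x ^+ 2 + g2 x ^+ 2 + V x * u x ^+ 2)%:E))%E.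

(* u (with distributional gradient (g1,g2)) belongs to H^1_V(R^2), the
   completion of C_0^infinity(R^2) w.r.t. ||.||_V: it is the ||.||_V-limit of
   test functions. *)
Definition in_H1V (V u g1 g2 : pt -> R) :=
  weak_grad u g1 g2 /\
  exists phi : nat -> pt -> R^o, (forall k, test_fun (phi k)) /\
    (fun k => normV2 V (fun x => u x - phi k x) (fun x => g1 x - dx (phi k) x)
                     (fun x => g2 x - dy (phi k) x)) @ \oo --> 0%E.

Definition ball2 (xi : pt) (r : R) : set pt :=
  [set x | (x.1 - xi.1) ^+ 2 + (x.2 - xi.2) ^+ 2 < r ^+ 2].

End Defs.

(* Main.v *)
Require Import Defs.
From HB Require Import structures.
From mathcomp Require Import all_boot all_order all_algebra.
From mathcomp Require Import all_classical all_reals all_analysis.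
From mathcomp Require Import measurable_realfun ring lra.
Import Order.TTheory GRing.Theory Num.Theory.
Import numFieldNormedType.Exports.
Local Open Scope classical_set_scope.
Local Open Scope ring_scope.

(** Formally [V^(1/2)] has gradient at most [C/2 V], so that for a test function
    [p] the function [W = V^(1/2) p^(n+1)] satisfies
    [|grad W| <= (n+1) V^(1/2) |p|^n |grad p| + C/2 V |p|^(n+1)].  The Sobolev
    embedding of [W^{1,1}] into [L^2] on a square [Q] of side [r], followed by
    Cauchy-Schwarz, gives
    [int_Q V p^(2n+2) <= K (int_Q V p^(2n) int_Q |grad p|^2 + (int_Q V |p|^(n+1))^2)].
    Summing over a grid of squares, [n = 1] bounds [int V p^4] by
    [sup_Q int_Q V p^2] times [||p||_V^2], which tends to [0], and induction on
    [n] bounds every [int V p^(2n)] in terms of [||p||_V].  Interpolation then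
    covers every [tau > 2].  The bounds pass from test functions to [H^1_V] by
    truncating at height [L] and letting [L] tend to infinity.

    No derivative of [V^(1/2)] is ever taken: testing the weak gradient against
    tensor products of bumps bounds the right Dini derivatives of [V] along the
    axes, and these control [W] on lines. *)

(** * Smooth functions of one variable *)

(** Since the bound [C V^(3/2)] is continuous, an almost everywhere bound on the weak gradient
    becomes a bound on the increments of [V] at every point. A continuous function whose right
    increments at each [x] are at most [h x + e] times the step then varies by at most the integral
    of [h].

    On a square the one-dimensional bound carries a zero-order term [r^-1 |W|]. The lower bound
    [V >= c] absorbs it: [V^(1/2) <= V / c^(1/2)] gives it the form of the term coming from the
    growth of [V]. The constant depends on [C], [c], [r] and [n], not on the position of the square.

    The exponent 4 is special because for [n = 1] both [2n] and [n + 1] equal 2: each product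
    contains the small factor [int_Q V p^2], whereas larger [n] give boundedness only.

    Test functions approach an element of [H^1_V] in a weighted [L^2] sense, which does not control
    higher powers. After truncation at height [L], the error in the power [k + 2] is at most a
    multiple of [L^k] times the squared [L^2] error; the approximant is chosen after [L], and no
    subsequence is extracted. *)

Fixpoint smooth1 {R : realType} (k : nat) (f : R -> R) : Prop :=
  match k with
  | 0%N => continuous f
  | k'.+1 => (forall x, derivable f x 1) /\ smooth1 k' (derive1 f)
  end.

Section smooth1.
Context {R : realType}.
Implicit Types f g : R -> R.

Lemma derive1_is_derive f (f' : R -> R) :
  (forall x, is_derive x (1:R) f (f' x)) -> derive1 f = f'.
Proof. by move=> h; apply/funext => x; rewrite derive1E; have [] := h x. Qed.

Lemma smooth1S k f (f' : R -> R) :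
  (forall x, is_derive x (1:R) f (f' x)) -> smooth1 k f' -> smooth1 k.+1 f.
Proof.
move=> h; rewrite /= (derive1_is_derive _ _ h); by split.
Qed.

Lemma smooth1_is_derive k f x :
  smooth1 k.+1 f -> is_derive x (1:R) f (derive1 f x).
Proof. by case=> d _; rewrite derive1E; exact: derivableP. Qed.

Lemma smooth1_continuous k f : smooth1 k f -> continuous f.
Proof.
case: k => [//|k] [d _] x.
by apply: differentiable_continuous; apply/derivable1_diffP.
Qed.

Lemma smooth1W k f : smooth1 k.+1 f -> smooth1 k f.
Proof.
elim: k f => [f /smooth1_continuous//|k ih f [d h]]; split => //.
exact: ih.
Qed.

Lemma smooth1_cst k (c : R) : smooth1 k (cst c).
Proof.
elim: k c => [|k ih] c; first exact: cst_continuous.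
by apply: (@smooth1S _ _ (cst 0)) => // x; exact: is_derive_cst.
Qed.

Lemma smooth1D k f g : smooth1 k f -> smooth1 k g -> smooth1 k (f \+ g).
Proof.
elim: k f g => [|k ih] f g hf hg.
  by move=> x; apply: cvgD; [exact: hf|exact: hg].
apply: (@smooth1S _ _ (derive1 f \+ derive1 g)) => [x|].
  have := smooth1_is_derive _ _ x hf; have := smooth1_is_derive _ _ x hg.
  move=> ? ?; exact: is_deriveD.
by apply: ih; [case: hf|case: hg].
Qed.

Lemma smooth1M k f g : smooth1 k f -> smooth1 k g -> smooth1 k (f \* g).
Proof.
elim: k f g => [|k ih] f g hf hg.
  by move=> x; apply: cvgM; [exact: hf|exact: hg].
apply: (@smooth1S _ _ ((f \* derive1 g) \+ (g \* derive1 f))) => [x|].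
  have := smooth1_is_derive _ _ x hf; have := smooth1_is_derive _ _ x hg.
  move=> ? ?; exact: is_deriveM.
by apply: smooth1D; apply: ih; (try exact: smooth1W);
  [case: hg|case: hf].
Qed.

Lemma smooth1V k f : (forall x, f x != 0) -> smooth1 k f ->
  smooth1 k (fun x => (f x)^-1).
Proof.
move=> f0; elim: k => [|k ih] hf.
  by move=> x; apply: cvgV => //; exact: hf.
apply: (@smooth1S _ _ (cst (-1) \* (((fun x => (f x)^-1) \* (fun x => (f x)^-1))
   \* derive1 f))) => [x|].
  have [hf1 _] := hf.
  apply: DeriveDef; first exact: derivableV.
  rewrite deriveV// /= derive1E /GRing.scale/= -exprVn expr2; ring.
apply: smooth1M; first exact: smooth1_cst.
apply: smooth1M; last by case: hf.
by apply: smooth1M; apply: ih; apply: smooth1W.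
Qed.

Lemma is_derive_affine f (f' c d x : R) : is_derive (c * x + d) (1:R) f f' ->
  is_derive x (1:R) (fun x => f (c * x + d)) (c * f').
Proof.
move=> h.
have h2 : is_derive x (1:R) (fun x : R => c * x + d : R) c.
  have -> : (fun x : R => c * x + d : R) = (c *: id) + cst d by [].
  apply: is_derive_eq; by rewrite addr0 /GRing.scale/= mulr1.
by have := @is_derive1_comp R f (fun x => c * x + d) x f' c h h2; rewrite mulrC.
Qed.

Lemma smooth1_affine k f (c d : R) : smooth1 k f ->
  smooth1 k (fun x => f (c * x + d)).
Proof.
elim: k f => [|k ih] f hf.
  move=> x; apply: (@continuous_comp _ _ _ (fun x : R => c * x + d) f); last exact: hf.
  by apply: cvgD; [apply: cvgM; [exact: cvg_cst|exact: cvg_id]|exact: cvg_cst].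
apply: (@smooth1S _ _ (cst c \* (fun x => derive1 f (c * x + d)))) => [x|].
  by apply: is_derive_affine; apply: smooth1_is_derive hf.
by apply: smooth1M; [exact: smooth1_cst|apply: ih; case: hf].
Qed.

End smooth1.

(** * The flat function [exp(-1/x)] and a smooth step *)

Section flat.
Context {R : realType}.

(* The class of functions [P(1/x) exp(-1/x)] extended by [0] is stable under
   differentiation. *)
Definition flat (P : {poly R}) (x : R) : R :=
  if 0 < x then P.[x^-1] * expR (- x^-1) else 0.

(** The factor [t ^+ n] makes the induction on the polynomial close, since multiplication by ['X]
    only raises [n]. A single power is controlled by the Taylor term of order [n.+1] of the
    exponential, whence the factorial. *)
Lemma horner_expRN_le (P : {poly R}) n : exists K : R, forall t : R, 0 < t ->
  `|P.[t] * t ^+ n * expR (- t)| <= K * t^-1.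
Proof.
elim/poly_ind: P n => [n|P c ih n].
  by exists 0 => t t0; rewrite horner0 !mul0r normr0.
have [K hK] := ih n.+1.
exists (K + `|c| * (n.+1)`!%:R) => t t0.
rewrite hornerD hornerM hornerX hornerC !mulrDl.
rewrite (le_trans (ler_normD _ _))// lerD//.
  by rewrite -(mulrA _ t) -exprS; exact: hK.
rewrite !normrM -!mulrA ler_wpM2l//.
have := expR_ge1Dxn n (ltW t0).
rewrite (ger0_norm (exprn_ge0 _ (ltW t0))) (ger0_norm (expR_ge0 _)) expRN.
move=> h; rewrite ler_pdivrMr ?expR_gt0// mulrAC ler_pdivlMr// -exprSr.
rewrite -ler_pdivrMl ?ltr0n ?fact_gt0// mulrC; apply: le_trans h.
by rewrite lerDr.
Qed.

(** With [t = 1/x], decay at infinity becomes a linear bound near [0]. Applied to ['X * P], it shows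
    that the difference quotients of [flat P] at [0] tend to [0]. *)
Lemma flat_le (P : {poly R}) : exists2 K : R, 0 <= K &
  forall x, `|flat P x| <= K * `|x|.
Proof.
have [K hK] := horner_expRN_le P 0.
exists `|K| => // x; rewrite /flat; case: ifPn => x0; last first.
  by rewrite normr0 mulr_ge0.
have := hK x^-1; rewrite invr_gt0 => /(_ x0); rewrite expr0 mulr1 invrK => h.
rewrite (le_trans h)// (gtr0_norm x0) ler_wpM2r ?ler_norm//; exact: ltW.
Qed.

Lemma flat_ge0 (P : {poly R}) x : (forall t, 0 <= t -> 0 <= P.[t]) ->
  0 <= flat P x.
Proof.
move=> h; rewrite /flat; case: ifPn => // x0.
by rewrite mulr_ge0 ?expR_ge0// h// invr_ge0 ltW.
Qed.

Lemma flat_le0 (P : {poly R}) x : x <= 0 -> flat P x = 0.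
Proof. by rewrite /flat leNgt; case: ifPn. Qed.

Lemma flat1_gt0 x : 0 < x -> 0 < flat 1 x.
Proof. by rewrite /flat => ->; rewrite hornerC mul1r expR_gt0. Qed.

(** For positive [x] the exponential contributes [P] and the polynomial [- P'], both with the factor
    [x^-2]; this is the new polynomial. At [0], dividing by [h] amounts to replacing [P] by
    ['X * P], so the difference quotient stays in the class. *)
Lemma is_derive_flat (P : {poly R}) x :
  is_derive x (1:R) (flat P) (flat ('X^2 * (P - P^`())) x).
Proof.
have [x0|x0|->] := ltgtP x 0.
- rewrite flat_le0; last exact: ltW.
  apply: (@near_eq_is_derive _ _ _ (cst 0)).
    near=> y; rewrite flat_le0//; near: y.
    exact: lt_le_nbhsl.
- have -> : flat ('X^2 * (P - P^`())) x =
    (P.[x^-1] * (expR (- x^-1) * (x^-1 * x^-1)) + expR (- x^-1) * (P^`().[x^-1] * (- (x^-1 * x^-1)))).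
    by rewrite /flat x0 hornerM hornerXn hornerD hornerN; ring.
  apply: (@near_eq_is_derive _ _ _ ((horner P \o (fun y : R => y^-1)) *
      (expR \o (fun y : R => - y^-1)))).
    near=> y; rewrite /flat ifT//; near: y; exact: lt_nbhsr.
  have xn0 : x != 0 by rewrite gt_eqF.
  have hV : is_derive x (1:R) (fun y : R => y^-1) (- (x^-1 * x^-1)).
    apply: DeriveDef; first by apply: (@derivableV _ _ id).
    rewrite (@deriveV _ _ id)// derive_id /GRing.scale/= mulr1.
    by rewrite -exprVn expr2.
  have hN : is_derive x (1:R) (fun y : R => - y^-1) (x^-1 * x^-1).
    rewrite -[X in is_derive _ _ _ X]opprK; exact: is_deriveN.
  have h1 := @is_derive1_comp R (horner P) (fun y => y^-1) x _ _ (is_derive_poly _ _) hV.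
  have h2 := @is_derive1_comp R expR (fun y => - y^-1) x _ _ (is_derive_expR _) hN.
  exact: is_deriveM.
rewrite flat_le0//.
have [K K0 hK] := flat_le ('X * P).
suff h : h^-1 *: ((flat P \o shift 0) (h *: (1:R)) - flat P 0) @[h --> 0^'] --> (0:R).
  apply: DeriveDef; first by apply: cvgP h.
  exact: (cvg_lim (@Rhausdorff R) h).
have e (h : R) : h^-1 *: ((flat P \o shift 0) (h *: (1:R)) - flat P 0) = flat ('X * P) h.
  rewrite /= [_%:A]mulr1 addr0 (@flat_le0 _ 0)// subr0 /flat /GRing.scale/=.
  by case: ifPn => _; rewrite ?mulr0// hornerM hornerX mulrA.
under eq_fun do rewrite e.
apply/norm_cvg0P.
apply: (@squeeze_cvgr _ _ _ _ (cst 0) (fun x => K * `|x|)).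
- by near=> y; rewrite normr_ge0 hK.
- exact: cvg_cst.
- rewrite -[X in _ --> X](mulr0 K); apply: cvgM; first exact: cvg_cst.
  apply/norm_cvg0P.
  exact: nbhs_dnbhs.
Unshelve. all: by end_near. Qed.

Lemma smooth1_flat k (P : {poly R}) : smooth1 k (flat P).
Proof.
elim: k P => [|k ih] P.
  by apply: (@smooth1_continuous _ 1); apply: smooth1S (is_derive_flat P) _ => x;
   apply: differentiable_continuous; apply/derivable1_diffP;
   have [] := is_derive_flat ('X^2 * (P - P^`())) x.
exact: smooth1S (is_derive_flat P) _.
Qed.

(** One function supplies every test function of the proof: the derivative of a rescaled step is a
    nonnegative mollifier, and the difference of two steps is a cutoff. Monotonicity is what makes
    both nonnegative. *)
Lemma smooth_step : exists E : R -> R, [/\ forall k, smooth1 k E,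
  forall x, x <= 0 -> E x = 0, forall x, 1 <= x -> E x = 1 &
  forall x, 0 <= derive1 E x].
Proof.
(* The step is [f(x) / (f(x) + f(1 - x))]; the denominator is positive because [x] and [1 - x] are
   never both nonpositive. *)
pose f := flat 1; pose g x := f x + f (-1 * x + 1).
have g0 x : 0 < g x.
  have f0 y : 0 <= f y by apply: flat_ge0 => t _; rewrite hornerC.
  have [x0|x0] := leP x 0; last by rewrite ltr_pwDl// flat1_gt0.
  by rewrite ltr_wpDl// flat1_gt0// mulN1r addrC subr_gt0 (le_lt_trans x0).
have gn0 x : g x != 0 by rewrite gt_eqF.
have sf k : smooth1 k f by exact: smooth1_flat.
have sg k : smooth1 k g by apply: smooth1D => //; exact: smooth1_affine.
exists (f \* (fun x => (g x)^-1)); split.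
- by move=> k; apply: smooth1M => //; exact: smooth1V.
- by move=> x x0; rewrite /= /f flat_le0// mul0r.
- move=> x x1 /=; rewrite /g [X in _ + X]flat_le0 ?addr0 ?divff//.
    by have := gn0 x; rewrite /g [X in _ + X]flat_le0 ?addr0// mulN1r addrC subr_le0.
  by rewrite mulN1r addrC subr_le0.
- move=> x.
  pose f' := flat ('X^2 * (1 - 1^`())).
  have f'0 y : 0 <= f' y.
    apply: flat_ge0 => t t0; rewrite !hornerE derivC hornerC subr0 mulr1.
    by rewrite exprn_ge0.
  have f0 y : 0 <= f y by apply: flat_ge0 => t _; rewrite hornerC.
  have h1 : is_derive x (1:R) f (f' x) by exact: is_derive_flat.
  have h2 : is_derive x (1:R) g (f' x + (- 1) * f' (-1 * x + 1)).
    apply: is_deriveD; apply: is_derive_affine; exact: is_derive_flat.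
  have h3 : is_derive x (1:R) (fun x => (g x)^-1) (- (g x) ^- 2 *: (f' x + (- 1) * f' (-1 * x + 1))).
    apply: DeriveDef; first by apply: derivableV => //.
    by rewrite deriveV//; congr (_ *: _); have [] := h2.
  have := is_deriveM h1 h3 => -[_].
  rewrite derive1E => ->.
  (* In the quotient rule the terms [f f'] cancel, and only products of nonnegative factors
     remain. *)
  rewrite (_ : _ + _ = (g x)^-1 * (g x)^-1 * (f x * f' (-1 * x + 1) + f' x * f (-1 * x + 1))); last first.
    have := gn0 x; rewrite /GRing.scale/= /g => gx.
    by field.
  by rewrite mulr_ge0// ?addr_ge0 ?mulr_ge0// ?invr_ge0 ltW.
Qed.

End flat.

(** * Tensor products *)

Section tensor.
Context {R : realType}.

Definition tensor (a b : R -> R) : pt R -> R^o := fun z => a z.1 * b z.2.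

Lemma is_diff_fst (z : R * R) : is_diff z (fst : R * R -> R) fst.
Proof.
have c : continuous (fst : R * R -> R) by move=> w; exact: cvg_fst.
apply: DiffDef; first exact: (@linear_differentiable _ _ _ fst).
by rewrite (@diff_lin _ _ _ fst).
Qed.

Lemma is_diff_snd (z : R * R) : is_diff z (snd : R * R -> R) snd.
Proof.
have c : continuous (snd : R * R -> R) by move=> w; exact: cvg_snd.
apply: DiffDef; first exact: (@linear_differentiable _ _ _ snd).
by rewrite (@diff_lin _ _ _ snd).
Qed.

Lemma is_diff_tensor (a b a' b' : R -> R) (z : pt R) :
  is_derive z.1 (1:R) a (a' z.1) -> is_derive z.2 (1:R) b (b' z.2) ->
  is_diff (z : pt R) (tensor a b)
    (fun v => a z.1 * (v.2 * b' z.2) + b z.2 * (v.1 * a' z.1)).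
Proof.
move=> ha hb.
have hda : is_diff (z.1 : R) (a : R -> R) ((fun h : R => h * a' z.1) : R -> R).
  apply: DiffDef; first by apply/derivable1_diffP; case: ha.
  by rewrite deriv1E// derive1E; have [_ ->] := ha.
have hdb : is_diff (z.2 : R) (b : R -> R) ((fun h : R => h * b' z.2) : R -> R).
  apply: DiffDef; first by apply/derivable1_diffP; case: hb.
  by rewrite deriv1E// derive1E; have [_ ->] := hb.
have h1 := @is_diff_comp R _ _ _ _ _ _ _ z (is_diff_fst z) hda.
have h2 := @is_diff_comp R _ _ _ _ _ _ _ z (is_diff_snd z) hdb.
exact: (is_diffM h1 h2).
Qed.

Section deriv.
Variables (a b : R -> R).
Hypotheses (da : forall x, derivable a x 1) (db : forall x, derivable b x 1).

Let hd z := is_diff_tensor a b (derive1 a) (derive1 b) z.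

Let ia x : is_derive x (1:R) a (derive1 a x).
Proof. by rewrite derive1E; exact: derivableP. Qed.
Let ib x : is_derive x (1:R) b (derive1 b x).
Proof. by rewrite derive1E; exact: derivableP. Qed.

Lemma differentiable_tensor z : differentiable (tensor a b) z.
Proof. by have [] := hd z (ia _) (ib _). Qed.

Lemma dx_tensor : dx (tensor a b) = tensor (derive1 a) b.
Proof.
apply/funext => z; rewrite /dx deriveE; last exact: differentiable_tensor.
have [_ ->] := hd z (ia _) (ib _).
by rewrite /tensor /= mul0r mulr0 add0r mul1r mulrC.
Qed.

Lemma dy_tensor : dy (tensor a b) = tensor a (derive1 b).
Proof.
apply/funext => z; rewrite /dy deriveE; last exact: differentiable_tensor.
have [_ ->] := hd z (ia _) (ib _).
by rewrite /tensor /= mul0r mulr0 addr0 mul1r.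
Qed.
End deriv.

Lemma tensor_continuous a b : continuous a -> continuous b ->
  continuous (tensor a b).
Proof.
move=> ca cb z; apply: cvgM.
  by apply: (@continuous_comp _ _ _ fst a z); [exact: cvg_fst|exact: ca].
by apply: (@continuous_comp _ _ _ snd b z); [exact: cvg_snd|exact: cb].
Qed.

Lemma Ck_tensor k a b : smooth1 k a -> smooth1 k b -> Ck k (tensor a b).
Proof.
elim: k a b => [|k ih] a b sa sb; first exact: tensor_continuous.
have [da sa'] := sa; have [db sb'] := sb.
split; first exact: differentiable_tensor.
rewrite dx_tensor// dy_tensor//; split; apply: ih => //; exact: smooth1W.
Qed.

Lemma test_fun_tensor (a b : R -> R) (M : R) :
  (forall k, smooth1 k a) -> (forall k, smooth1 k b) ->
  (forall x, M < `|x| -> a x = 0) -> (forall x, M < `|x| -> b x = 0) ->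
  test_fun (tensor a b).
Proof.
move=> sa sb a0 b0; split; first by move=> k; exact: Ck_tensor.
by exists M => z [/a0|/b0] h; rewrite /tensor h ?mul0r ?mulr0.
Qed.

End tensor.

(** * Borel measurability for the product sigma-algebra *)

Section measurable.
Context {R : realType}.

(** The sigma-algebra on [pt R] is generated by rectangles, so second countability enters: an open
    set is the countable union of the rational boxes that it contains. *)
Lemma open_measurable2 (U : set (pt R)) : open U -> measurable U.
Proof.
move=> oU.
pose box (q : rat * rat * rat) : set (pt R) :=
  `](ratr q.1.1 - ratr q.2), (ratr q.1.1 + ratr q.2)[ `*`
  `](ratr q.1.2 - ratr q.2), (ratr q.1.2 + ratr q.2)[.
pose F q := if `[< box q `<=` U >] then box q else set0.
have -> : U = \bigcup_q F q.
  apply/seteqP; split=> [[x y] Uxy|z [q _]]; last first.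
    by rewrite /F; case: ifPn => // /asboolP; exact.
  have /nbhs_ballP[e /= e0 he] : nbhs (x, y) U by exact: open_nbhs_nbhs.
  have e4 : 0 < e / 4 by rewrite divr_gt0.
  (* A centre within [e / 4] and a half-side between [e / 4] and [e / 2] make the box contain the
     point and stay within [3 e / 4] of it. *)
  have [d /itvP dP] : exists d : rat, ratr d \in `]e / 4, e / 2[.
    by apply: rat_in_itvoo; lra.
  have [p /itvP pP] : exists p : rat, ratr p \in `](x - e/4), (x + e/4)[.
    by apply: rat_in_itvoo; lra.
  have [q /itvP qP] : exists q : rat, ratr q \in `](y - e/4), (y + e/4)[.
    by apply: rat_in_itvoo; lra.
  have [d1 d2] : e / 4 < ratr d /\ ratr d < e / 2 by rewrite !dP.
  have [p1 p2] : x - e / 4 < ratr p /\ ratr p < x + e / 4 by rewrite !pP.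
  have [q1 q2] : y - e / 4 < ratr q /\ ratr q < y + e / 4 by rewrite !qP.
  exists (p, q, d) => //; rewrite /F; case: ifPn => [_|].
    by split; rewrite /= in_itv/=; lra.
  move/asboolP => [] [s t] [/=]; rewrite !in_itv/= => /andP[s1 s2] /andP[t1 t2].
  apply: he; split => /=; rewrite /ball/= ltr_norml; lra.
apply: countable_bigcupT_measurable => [|q]; first exact: countableP.
rewrite /F; case: ifPn => // _; apply: measurableX; exact: measurable_itv.
Qed.

Lemma continuous_measurable_fun2 (f : pt R -> R) : continuous f ->
  measurable_fun [set: pt R] f.
Proof.
move=> /continuousP cf; apply: (measurability _ (RGenOpens.measurableE R)).
move=> _ [_ [a [b ->] <-]]; apply: measurableI => //.
by apply: open_measurable2; exact/cf/interval_open.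
Qed.

End measurable.

(** * Integrals of real-valued functions *)

Section integral_real.
Context {d} {T : measurableType d} {R : realType}.
Variable mu : {measure set T -> \bar R}.

Lemma le_integral_real (D : set T) (f g : T -> R) : measurable D ->
  measurable_fun D f -> measurable_fun D g ->
  (forall x, D x -> 0 <= f x) -> (forall x, D x -> f x <= g x) ->
  (\int[mu]_(x in D) (f x)%:E <= \int[mu]_(x in D) (g x)%:E)%E.
Proof.
move=> mD mf mg f0 fg; apply: ge0_le_integral => //.
- exact/measurable_EFinP.
- exact/measurable_EFinP.
Qed.

Lemma integral_realZ (D : set T) (k : R) (f : T -> R) : measurable D ->
  measurable_fun D f -> (forall x, D x -> 0 <= f x) -> 0 <= k ->
  (\int[mu]_(x in D) (k * f x)%:E = k%:E * \int[mu]_(x in D) (f x)%:E)%E.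
Proof.
move=> mD mf f0 k0; under eq_integral do rewrite EFinM.
by rewrite ge0_integralZl//; exact/measurable_EFinP.
Qed.

Lemma integral_realD (D : set T) (f g : T -> R) : measurable D ->
  measurable_fun D f -> measurable_fun D g ->
  (forall x, D x -> 0 <= f x) -> (forall x, D x -> 0 <= g x) ->
  (\int[mu]_(x in D) (f x + g x)%:E =
   \int[mu]_(x in D) (f x)%:E + \int[mu]_(x in D) (g x)%:E)%E.
Proof.
move=> mD mf mg f0 g0; under eq_integral do rewrite EFinD.
by rewrite ge0_integralD//; exact/measurable_EFinP.
Qed.

(** The weight [A] acts as an approximate point mass: where it is nonzero, [V] differs from [va] by
    at most [t]. That also bounds [V] there, which gives the integrability of [V A]. The integral is
    named as a real [xa] so that later estimates are real arithmetic. *)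
Lemma integral_concentrated (V A : T -> R) (m va t : R) :
  measurable_fun setT V -> measurable_fun setT A -> (forall x, 0 <= A x) ->
  (\int[mu]_x (A x)%:E = m%:E)%E ->
  (forall x, A x != 0 -> `|V x - va| <= t) ->
  mu.-integrable setT (EFin \o (V \* A)) /\
  exists2 xa, (\int[mu]_x (V x * A x)%:E = xa%:E)%E & `|xa - va * m| <= t * m.
Proof.
move=> mV mA A0 Am Vt.
have mEA : measurable_fun setT (EFin \o A) by exact/measurable_EFinP.
have iA : mu.-integrable setT (EFin \o A).
  apply/integrableP; split => //.
  by under eq_integral do rewrite /= ger0_norm//; rewrite Am ltry.
have mVA : measurable_fun setT (V \* A) by exact: measurable_funM.
have VA x : `|(V x - va) * A x| <= t * A x.
  have [->|Ax] := eqVneq (A x) 0; first by rewrite !mulr0 normr0.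
  by rewrite normrM (ger0_norm (A0 x)) ler_wpM2r// Vt.
have iVA : mu.-integrable setT (EFin \o (V \* A)).
  apply: (@le_integrable _ _ _ _ _ _ _ (fun x => (`|va| + t)%:E * (A x)%:E)%E) => //.
  - exact/measurable_EFinP.
  - move=> x _ /=; rewrite lee_fin.
    apply: (@le_trans _ _ ((`|va| + t) * A x)); last exact: ler_norm.
    have -> : V x * A x = va * A x + (V x - va) * A x by ring.
    rewrite (le_trans (ler_normD _ _))// [leRHS]mulrDl lerD ?VA//.
    by rewrite normrM (ger0_norm (A0 x)).
  - exact: integrableZl.
split => //.
have ivaA : mu.-integrable setT (EFin \o (cst va \* A)).
  exact: (integrableZl measurableT va iA).
have fVA := integrable_fin_num measurableT iVA.
exists (fine (\int[mu]_x (V x * A x)%:E)%E); first by rewrite fineK.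
have eva : (\int[mu]_x (va * A x)%:E = (va * m)%:E)%E.
  under eq_integral do rewrite EFinM.
  by rewrite integralZl// Am.
have := integralB_EFin measurableT iVA ivaA.
rewrite /= eva -[X in (_ = X - _)%E -> _]fineK// -EFinB => h.
rewrite -lee_fin -abse_EFin -h.
have mdiff : measurable_fun setT (EFin \o (fun x => V x * A x - va * A x)).
  by apply/measurable_EFinP/measurable_funB => //; exact: measurable_funM.
apply: (le_trans (le_abse_integral _ _ mdiff)) => //.
have t0 : (\int[mu]_x (t * A x)%:E = (t * m)%:E)%E.
  under eq_integral do rewrite EFinM.
  by rewrite integralZl// Am.
rewrite -t0; apply: ge0_le_integral => //.
- by apply: measurableT_comp => //; exact: mdiff.
- by apply/measurable_EFinP; exact: measurable_funM.
- by move=> x _; rewrite /= -mulrBl lee_fin VA.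
Qed.

(** A weak mean value inequality. [A] and [B] are bumps of mass [m] at two points, and [D] is a
    primitive of [A - B] along the segment joining them, of mass at most [l m]. Replacing the values
    of [V] by averages costs [t] at each end; the gradient contributes [S l]. *)
Lemma weak_increment (V G U A B D : T -> R) (va vb t S l m : R) :
  measurable_fun setT V -> measurable_fun setT G -> measurable_fun setT A ->
  measurable_fun setT B -> measurable_fun setT D ->
  (forall x, 0 <= A x) -> (forall x, 0 <= B x) -> (forall x, 0 <= D x) ->
  0 < m -> 0 <= S ->
  (\int[mu]_x (A x)%:E = m%:E)%E -> (\int[mu]_x (B x)%:E = m%:E)%E ->
  (\int[mu]_x (D x)%:E <= (l * m)%:E)%E ->
  (forall x, A x != 0 -> `|V x - va| <= t) ->
  (forall x, B x != 0 -> `|V x - vb| <= t) ->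
  {ae mu, forall x, `|G x| <= U x} -> (forall x, D x != 0 -> U x <= S) ->
  (\int[mu]_x (V x * (A x - B x))%:E = - \int[mu]_x (G x * D x)%:E)%E ->
  `|vb - va| <= S * l + 2 * t.
Proof.
move=> mV mG mA mB mD A0 B0 D0 m0 S0 Am Bm Dl VA VB GU US.
have [iA [xa ea ha]] := integral_concentrated V A m va t mV mA A0 Am VA.
have [iB [xb eb hb]] := integral_concentrated V B m vb t mV mB B0 Bm VB.
have mGD : measurable_fun setT (fun x => G x * D x) by exact: measurable_funM.
have -> : (\int[mu]_x (V x * (A x - B x))%:E = xa%:E - xb%:E)%E.
  under eq_integral do rewrite mulrBr EFinB.
  by rewrite (integralB_EFin measurableT iA iB)/= ea eb.
move=> h.
have h1 : (`|\int[mu]_x (G x * D x)%:E| <= (S * (l * m))%:E)%E.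
  apply: (le_trans (le_abse_integral _ _ _)) => //; first exact/measurable_EFinP.
  apply: (@le_trans _ _ (S%:E * \int[mu]_x (D x)%:E)%E); last first.
    by rewrite EFinM lee_wpmul2l.
  rewrite -integral_realZ//.
  apply: ae_ge0_le_integral => //.
  - by apply: measurableT_comp => //; exact/measurable_EFinP.
  - by move=> x _; rewrite lee_fin mulr_ge0.
  - by apply/measurable_EFinP; exact: measurable_funM.
  - move: GU; apply: filterS => x Gx _; rewrite abse_EFin lee_fin.
    have [->|Dx] := eqVneq (D x) 0; first by rewrite !mulr0 normr0.
    by rewrite normrM (ger0_norm (D0 x)) ler_wpM2r// (le_trans Gx)// US.
have {}h : `|xb - xa| <= S * (l * m).
  by rewrite distrC -lee_fin -abse_EFin EFinB h abseN.
rewrite -(ler_pM2r m0).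
have -> : (S * l + 2 * t) * m = S * (l * m) + (t * m + t * m) by ring.
rewrite -[X in _ * X](gtr0_norm m0) -normrM.
have -> : (vb - va) * m = (xb - xa) + ((xa - va * m) - (xb - vb * m)) by ring.
rewrite (le_trans (ler_normD _ _))// lerD//.
by rewrite (le_trans (ler_normB _ _))// lerD.
Qed.

Lemma ae_sub (P Q : T -> Prop) : (forall x, P x -> Q x) ->
  {ae mu, forall x, P x} -> {ae mu, forall x, Q x}.
Proof. by move=> PQ; apply: filterS. Qed.

End integral_real.

(** * Iterated integrals over the plane *)

Section tensor_integral.
Context {R : realType}.
Local Notation leb := (@lebesgue_measure R).

Lemma tonelli1 (f : pt R -> \bar R) : measurable_fun [set: pt R] f ->
  (forall z, (0 <= f z)%E) ->
  (\int[@mu2 R]_z f z = \int[leb]_x \int[leb]_y f (x, y))%E.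
Proof. by move=> mf f0; exact: (@fubini_tonelli1 _ _ _ _ R leb leb f mf f0). Qed.

Lemma tonelli2 (f : pt R -> \bar R) : measurable_fun [set: pt R] f ->
  (forall z, (0 <= f z)%E) ->
  (\int[@mu2 R]_z f z = \int[leb]_y \int[leb]_x f (x, y))%E.
Proof. by move=> mf f0; exact: (@fubini_tonelli2 _ _ _ _ R leb leb f mf f0). Qed.

Lemma measurable_tensor (a b : R -> R) : measurable_fun setT a ->
  measurable_fun setT b -> measurable_fun [set: pt R] (tensor a b).
Proof.
move=> ma mb; apply: measurable_funM.
  exact: (measurableT_comp ma measurable_fst).
exact: (measurableT_comp mb measurable_snd).
Qed.

Lemma integral_tensor (a b : R -> R) : measurable_fun setT a ->
  measurable_fun setT b -> (forall x, 0 <= a x) -> (forall x, 0 <= b x) ->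
  (\int[@mu2 R]_z (tensor a b z)%:E =
   \int[leb]_x (a x)%:E * \int[leb]_x (b x)%:E)%E.
Proof.
move=> ma mb a0 b0.
rewrite (tonelli1 (fun z => (tensor a b z)%:E)); last 2 first.
- by apply/measurable_EFinP; exact: measurable_tensor.
- by move=> z; rewrite lee_fin mulr_ge0.
rewrite /tensor/=.
rewrite -ge0_integralZr//; last 3 first.
- exact/measurable_EFinP.
- by move=> x _; rewrite lee_fin.
- by apply: integral_ge0 => x _; rewrite lee_fin.
by apply: eq_integral => x _; rewrite integral_realZ.
Qed.

End tensor_integral.

(** * Directional increments *)

Section step.
Context {R : realType}.
Local Notation leb := (@lebesgue_measure R).
Variable E : R -> R.
Hypothesis smE : forall k, smooth1 k E.
Hypothesis E_le0 : forall x, x <= 0 -> E x = 0.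
Hypothesis E_ge1 : forall x, 1 <= x -> E x = 1.
Hypothesis dE_ge0 : forall x, 0 <= derive1 E x.

Let E_nd x y : x <= y -> E x <= E y.
Proof.
move=> xy; have [dE _] := smE 1.
apply: (@ger0_derive1_ndecr R E x y) => //.
by apply: continuous_subspaceT; exact: smooth1_continuous (smE 0).
Qed.

(** Written in the shape [c * x + d] of [smooth1_affine]. The rise takes place on [[a, a + e]], so
    the derivative is a mollifier lying to the right of [a]. *)
Definition step (e a x : R) := E (e^-1 * x + - (e^-1 * a)).

(** A primitive of the difference of the two mollifiers at [a] and [b]: it rises just after [a] and
    falls just after [b]. *)
Definition plateau (e a b : R) := step e a \+ (cst (-1) \* step e b).

Variable e : R.
Hypothesis e0 : 0 < e.

Let stepE a x : e^-1 * x + - (e^-1 * a) = (x - a) / e.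
Proof. by rewrite mulrBl mulrC [X in - X]mulrC. Qed.

Lemma smooth1_step k a : smooth1 k (step e a).
Proof. exact: smooth1_affine. Qed.

Lemma smooth1_dstep k a : smooth1 k (derive1 (step e a)).
Proof. by have [] := smooth1_step k.+1 a. Qed.

Lemma smooth1_plateau k a b : smooth1 k (plateau e a b).
Proof.
apply: smooth1D; first exact: smooth1_step.
by apply: smooth1M; [exact: smooth1_cst|exact: smooth1_step].
Qed.

Lemma dstep_ge0 a x : 0 <= derive1 (step e a) x.
Proof.
have h := is_derive_affine E _ _ _ x (smooth1_is_derive 0 E _ (smE 1)).
have -> : derive1 (step e a) x = e^-1 * derive1 E (e^-1 * x + - (e^-1 * a)).
  by rewrite derive1E; have [_ ->] := h (e^-1) (- (e^-1 * a)).
by rewrite mulr_ge0// invr_ge0 ltW.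
Qed.

Lemma step_le0 a x : x <= a -> step e a x = 0.
Proof.
by move=> xa; rewrite /step stepE E_le0// pmulr_lle0 ?invr_gt0// subr_le0.
Qed.

Lemma step_ge1 a x : a + e <= x -> step e a x = 1.
Proof.
by move=> xa; rewrite /step stepE E_ge1// ler_pdivlMr// mul1r lerBrDl.
Qed.

Lemma dstep_supp a x : derive1 (step e a) x != 0 -> a <= x <= a + e.
Proof.
apply: contraNT; rewrite negb_and -!ltNge => /orP[] xa; rewrite derive1E.
  rewrite (@near_eq_derive _ _ _ _ (cst 0)) ?derive_cst//.
  near=> y; rewrite step_le0//; near: y; exact: lt_le_nbhsl.
rewrite (@near_eq_derive _ _ _ _ (cst (1:R))) ?derive_cst//.
near=> y; rewrite step_ge1//; near: y; exact: lt_le_nbhsr.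
Unshelve. all: by end_near. Qed.

Lemma integral_dstep a : (\int[leb]_x (derive1 (step e a) x)%:E = 1%:E)%E.
Proof.
have cs : continuous (step e a) by exact: smooth1_continuous (smooth1_step 0 a).
have ae : a < a + e by rewrite ltrDl.
have <- : (\int[leb]_(x in `[a, (a + e)%R]) (derive1 (step e a) x)%:E = 1%:E)%E.
  rewrite (@continuous_FTC2 _ _ (step e a))//.
  - by rewrite step_ge1// step_le0// sube0.
  - apply: continuous_subspaceT; exact: smooth1_continuous (smooth1_dstep 0 a).
  - split.
    + by move=> x _; have [] := smooth1_step 1 a.
    + by apply: cvg_at_right_filter; exact: cs.
    + by apply: cvg_at_left_filter; exact: cs.
rewrite [RHS]integral_mkcond; apply: eq_integral => x _; rewrite patchE.
case: ifPn => //; rewrite notin_setE/= in_itv/= => /negP h.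
congr (_%:E); apply/eqP; move: h; apply: contraNT; exact: dstep_supp.
Qed.

Lemma plateau_ge0 a b x : a <= b -> 0 <= plateau e a b x.
Proof.
move=> ab; rewrite /plateau /= mulN1r subr_ge0 /step; apply: E_nd.
by rewrite lerD2l lerN2 ler_pM2l// invr_gt0.
Qed.

Lemma plateau_supp a b x : a <= b -> plateau e a b x != 0 -> a <= x <= b + e.
Proof.
move=> ab; apply: contraNT; rewrite /plateau /= negb_and -!ltNge => /orP[] xa.
  by rewrite !step_le0 ?mulr0 ?addr0// ltW// (lt_le_trans xa).
rewrite !step_ge1 ?mulr1 ?subrr// ltW//.
by rewrite (le_lt_trans _ xa)// lerD2r.
Qed.

Lemma plateau_le1 a b x : plateau e a b x <= 1.
Proof.
have h y : 0 <= E y <= 1.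
  apply/andP; split.
    by have [/E_le0->//|/ltW/E_nd] := leP y 0; rewrite (E_le0 0).
  by have [/E_ge1->//|/ltW/E_nd] := leP 1 y; rewrite (E_ge1 1).
rewrite /plateau /step /= mulN1r.
have /andP[_ h1] := h (e^-1 * x + - (e^-1 * a)).
have /andP[h2 _] := h (e^-1 * x + - (e^-1 * b)).
by rewrite (le_trans _ h1)// gerBl.
Qed.

Lemma integral_plateau a b : a <= b ->
  (\int[leb]_x (plateau e a b x)%:E <= (b - a + e)%:E)%E.
Proof.
move=> ab.
have mI : measurable `[a, b + e] by exact: measurable_itv.
apply: (@le_trans _ _ (\int[leb]_x (\1_(`[a, (b + e)%R]) x)%:E)%E).
  apply: le_integral_real => //.
  - apply: continuous_measurable_fun; exact: smooth1_continuous (smooth1_plateau 0 a b).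
  - by move=> x _; exact: plateau_ge0.
  - move=> x _; rewrite indicE; case: (boolP (x \in _)) => [_|]/=.
      exact: plateau_le1.
    rewrite notin_setE/= in_itv/= => h.
    have [->//|h2] := eqVneq (plateau e a b x) 0.
    by exfalso; apply: h; exact: plateau_supp.
rewrite integral_indic// setIT [leLHS](lebesgue_measure_itv `[a, b + e]%R)/= lte_fin.
rewrite (le_lt_trans ab) ?ltrDl// EFinN -EFinD lee_fin; lra.
Qed.

Lemma derive1_plateau a b : derive1 (plateau e a b) =
  fun x => derive1 (step e a) x - derive1 (step e b) x.
Proof.
apply: derive1_is_derive => x.
have ha := smooth1_is_derive 0 _ x (smooth1_step 1 a).
have hb := smooth1_is_derive 0 _ x (smooth1_step 1 b).
rewrite /plateau -[X in _ + X]mulN1r; apply: is_deriveD.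
exact: (is_deriveZ (-1) hb).
Qed.

End step.

(* The coordinates [c], [d] are [fst], [snd] in either order. *)
Section directional.
Context {R : realType}.
Local Notation leb := (@lebesgue_measure R).
Variables (V G U : pt R -> R) (c d : pt R -> R) (P : R -> R -> pt R).
Hypothesis mV : measurable_fun [set: pt R] V.
Hypothesis mG : measurable_fun [set: pt R] G.
Hypothesis mcd : forall a b : R -> R, measurable_fun setT a ->
  measurable_fun setT b -> measurable_fun [set: pt R] (fun z => a (c z) * b (d z)).
Hypothesis icd : forall a b : R -> R, measurable_fun setT a ->
  measurable_fun setT b -> (forall x, 0 <= a x) -> (forall x, 0 <= b x) ->
  (\int[@mu2 R]_z (a (c z) * b (d z))%:E =
   \int[leb]_x (a x)%:E * \int[leb]_x (b x)%:E)%E.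
Hypothesis wcd : forall (a b : R -> R) (M : R), (forall k, smooth1 k a) ->
  (forall k, smooth1 k b) -> (forall x, M < `|x| -> a x = 0) ->
  (forall x, M < `|x| -> b x = 0) ->
  (\int[@mu2 R]_z (V z * (derive1 a (c z) * b (d z)))%:E =
   - \int[@mu2 R]_z (G z * (a (c z) * b (d z)))%:E)%E.
Hypothesis cV : forall t w s, 0 < s -> exists2 r, 0 < r & forall z,
  `|c z - t| <= r -> `|d z - w| <= r -> `|V z - V (P t w)| <= s.
Hypothesis cU : forall t w s, 0 < s -> exists2 r, 0 < r & forall z,
  `|c z - t| <= r -> `|d z - w| <= r -> `|U z - U (P t w)| <= s.
Hypothesis GU : {ae @mu2 R, forall z, `|G z| <= U z}.
Hypothesis U0 : forall z, 0 <= U z.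

(** The weak gradient is tested against a plateau from [t] to [t'] along the axis times a mollifier
    across it, of common width [e]. For fixed [t'] the width is made as small as desired, whereas
    [r] depends only on the modulus of continuity of [U] at the starting point. *)
Lemma directional_increment t w s : 0 < s -> exists2 r, 0 < r &
  forall t', t < t' -> t' < t + r ->
  `|V (P t' w) - V (P t w)| <= (U (P t w) + s) * (t' - t).
Proof.
move=> s0; have [r r0 hr] := cU t w s s0.
(* The other half of [r] leaves room for the width [e]: the supports reach up to [t' + e]. *)
exists (r / 2); first by rewrite divr_gt0.
move=> t' tt' t'r; set S := U (P t w) + s.
have S0 : 0 <= S by rewrite addr_ge0// ltW.
apply/ler_addgt0Pr => h h0.
(* With [e <= q], the total error [S e + 2 q] is at most [(S + 2) q = h / 2]. *)
pose q := h / (2 * (S + 2)).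
have q0 : 0 < q by rewrite divr_gt0// mulr_gt0// ltr_wpDl.
have [r1 r10 hr1] := cV t w q q0.
have [r2 r20 hr2] := cV t' w q q0.
pose e := Num.min (Num.min r1 r2) (Num.min q (r / 2)).
have e0 : 0 < e by rewrite !lt_min r10 r20 q0 divr_gt0.
have [er1 er2 eq er] : [/\ e <= r1, e <= r2, e <= q & e <= r / 2].
  by split; rewrite !ge_min lexx ?orbT.
have [E [smE E_le0 E_ge1 dE_ge0]] := @smooth_step R.
have mc (f : R -> R) : smooth1 0 f -> measurable_fun setT f.
  by move=> /smooth1_continuous; exact: continuous_measurable_fun.
pose K := derive1 (step E e t); pose K' := derive1 (step E e t').
pose B := derive1 (step E e w); pose D := plateau E e t t'.
have mK : measurable_fun setT K by apply: mc; exact: smooth1_dstep.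
have mK' : measurable_fun setT K' by apply: mc; exact: smooth1_dstep.
have mB : measurable_fun setT B by apply: mc; exact: smooth1_dstep.
have mD : measurable_fun setT D by apply: mc; exact: smooth1_plateau.
have K0 x : 0 <= K x by exact: dstep_ge0.
have K'0 x : 0 <= K' x by exact: dstep_ge0.
have B0 x : 0 <= B x by exact: dstep_ge0.
have D0 x : 0 <= D x by apply: plateau_ge0 => //; exact: ltW.
have iK : (\int[leb]_x (K x)%:E = 1%:E)%E by exact: integral_dstep.
have iK' : (\int[leb]_x (K' x)%:E = 1%:E)%E by exact: integral_dstep.
have iB : (\int[leb]_x (B x)%:E = 1%:E)%E by exact: integral_dstep.
have sK x : K x != 0 -> t <= x <= t + e by exact: dstep_supp.
have sK' x : K' x != 0 -> t' <= x <= t' + e by exact: dstep_supp.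
have sB x : B x != 0 -> w <= x <= w + e by exact: dstep_supp.
have sD x : D x != 0 -> t <= x <= t' + e.
  by apply: plateau_supp => //; exact: ltW.
(* [M] bounds the supports. [w] is counted twice because [M0] is also used for the interval
   [[w, w + e]], both of whose reference points are [w]. *)
pose N := `|t| + `|t'| + `|w| + `|w|; pose M := N + e.
have M0 x y z : x <= z <= y + e -> `|x| + `|y| <= N -> `|z| <= M.
  move=> /andP[xz zy] hM; rewrite /M ler_norml.
  have := ler_norm (- x); have := ler_norm y; rewrite normrN => h1 h2.
  have := normr_ge0 x; have := normr_ge0 y => h3 h4.
  by apply/andP; split; lra.
have n1 := normr_ge0 t; have n2 := normr_ge0 t'; have n3 := normr_ge0 w.
have wk := wcd D B M
  (fun k => smooth1_plateau E smE e k t t') (fun k => smooth1_dstep E smE e k w).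
have inc := weak_increment (@mu2 R) V G U (fun z => K (c z) * B (d z))
  (fun z => K' (c z) * B (d z)) (fun z => D (c z) * B (d z))
  (V (P t w)) (V (P t' w)) q S (t' - t + e) 1 mV mG
  (mcd K B mK mB) (mcd K' B mK' mB) (mcd D B mD mB).
apply: (@le_trans _ _ (S * (t' - t + e) + 2 * q)).
  apply: inc => //.
  - by move=> z; rewrite mulr_ge0.
  - by move=> z; rewrite mulr_ge0.
  - by move=> z; rewrite mulr_ge0.
  - by rewrite icd// iK iB mule1.
  - by rewrite icd// iK' iB mule1.
  - rewrite icd// iB mule1 mulr1; apply: integral_plateau => //; exact: ltW.
  - move=> z; rewrite mulf_eq0 negb_or => /andP[/sK/andP[z1 z2] /sB/andP[z3 z4]].
    by apply: hr1; rewrite ger0_norm ?subr_ge0// (le_trans _ er1)// lerBlDl.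
  - move=> z; rewrite mulf_eq0 negb_or => /andP[/sK'/andP[z1 z2] /sB/andP[z3 z4]].
    by apply: hr2; rewrite ger0_norm ?subr_ge0// (le_trans _ er2)// lerBlDl.
  - move=> z; rewrite mulf_eq0 negb_or => /andP[/sD/andP[z1 z2] /sB/andP[z3 z4]].
    rewrite /S -lerBlDl (le_trans (ler_norm _))//.
    by apply: hr; rewrite ger0_norm ?subr_ge0//; lra.
  - rewrite -wk.
    + apply: eq_integral => z _; rewrite /D derive1_plateau//.
      by congr (_%:E); rewrite mulrBl.
    + move=> x Mx; apply/eqP; move: Mx; apply: contraTT => /sD/M0 h1.
      by rewrite -leNgt h1// /N; lra.
    + move=> x Mx; apply/eqP; move: Mx; apply: contraTT => /sB/M0 h1.
      by rewrite -leNgt h1// /N; lra.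
rewrite mulrDr -addrA lerD2l.
have -> : h = (S + 2) * q + (S + 2) * q.
  by rewrite /q; field; rewrite gt_eqF// ltr_wpDl.
have h1 : S * e <= S * q by rewrite ler_wpM2l.
have h2 : 0 <= S * q by rewrite mulr_ge0// ltW.
by clearbody q S; lra.
Qed.

End directional.

(** * Dini derivatives *)

Section dini_sqrt.
Context {R : realType}.

Lemma continuous2_le (f : pt R -> R) (p : pt R) (s : R) : continuous f -> 0 < s ->
  exists2 r, 0 < r & forall z : pt R,
    `|z.1 - p.1| <= r -> `|z.2 - p.2| <= r -> `|f z - f p| <= s.
Proof.
move=> cf s0; have /cvgrPdist_le /(_ s s0) /nbhs_ballP[e /= e0 he] := cf p.
exists (e / 2); first by rewrite divr_gt0.
move=> z z1 z2; rewrite distrC; apply: he; split; rewrite /ball/= distrC.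
  by rewrite (le_lt_trans z1)// ltr_pdivrMr// ltr_pMr// ltr1n.
by rewrite (le_lt_trans z2)// ltr_pdivrMr// ltr_pMr// ltr1n.
Qed.

Variables (V G1 G2 : pt R -> R) (C c : R).
Hypothesis V_cont : continuous V.
Hypothesis c0 : 0 < c.
Hypothesis V_ge : forall z, c <= V z.
Hypothesis C0 : 0 < C.
Hypothesis V_grad : weak_grad V G1 G2.
Hypothesis G_le : {ae @mu2 R, forall z,
  Num.sqrt (G1 z ^+ 2 + G2 z ^+ 2) <= C * V z `^ (3 / 2)}.

Let V0 z : 0 < V z.
Proof. exact: lt_le_trans (V_ge z). Qed.

Let s z := Num.sqrt (V z).
Let s0 z : 0 < s z. Proof. by rewrite sqrtr_gt0. Qed.
Let ss z : s z * s z = V z. Proof. by rewrite -expr2 sqr_sqrtr// ltW. Qed.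
Let U z := C * (V z * s z).

Lemma sqrtV_continuous : continuous (fun z => Num.sqrt (V z)).
Proof.
move=> z; apply: (@continuous_comp _ _ _ V (@Num.sqrt R)); first exact: V_cont.
exact: sqrt_continuous.
Qed.

Let U_cont : continuous U.
Proof.
move=> z; apply: cvgM; first exact: cvg_cst.
by apply: cvgM; [exact: V_cont|exact: sqrtV_continuous].
Qed.

Let powV z : V z `^ (3 / 2) = V z * s z.
Proof.
have -> : (3 / 2 : R) = 1 + 2^-1 by field.
by rewrite powRD ?powRr1 ?ltW// ?powR12_sqrt ?ltW// gt_eqF ?implybT// V0.
Qed.

Let mV : measurable_fun [set: pt R] V.
Proof. exact: continuous_measurable_fun2. Qed.

(** Here the almost everywhere hypothesis on the gradient turns into a statement at every point:
    [U = C V^(3/2)] dominates each partial derivative almost everywhere and is continuous. *)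
Lemma increment_fst t w e : 0 < e -> exists2 r, 0 < r &
  forall t', t < t' -> t' < t + r ->
  `|V (t', w) - V (t, w)| <= (C * (V (t, w) * Num.sqrt (V (t, w))) + e) * (t' - t).
Proof.
move=> e0; have [_ [mG1 _] _ wk] := V_grad.
apply: (@directional_increment R V G1 U fst snd pair) => //.
- by move=> a b ma mb; exact: measurable_tensor.
- by move=> a b ma mb a0 b0; exact: integral_tensor.
- move=> a b M sa sb a0 b0.
  have [+ _] := wk _ (test_fun_tensor a b M sa sb a0 b0).
  rewrite dx_tensor// => x.
    by have [] := sa 1.
  by have [] := sb 1.
- by move=> t1 w1 ? ?; exact: (continuous2_le V (t1, w1)).
- by move=> t1 w1 ? ?; exact: (continuous2_le U (t1, w1)).
- apply: (ae_sub (@mu2 R) _ _ _ G_le) => z; rewrite powV; apply: le_trans.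
  by rewrite -sqrtr_sqr ler_wsqrtr// lerDl sqr_ge0.
- by move=> z; rewrite mulr_ge0 ?mulr_ge0// ltW.
Qed.

Lemma increment_snd t w e : 0 < e -> exists2 r, 0 < r &
  forall t', t < t' -> t' < t + r ->
  `|V (w, t') - V (w, t)| <= (C * (V (w, t) * Num.sqrt (V (w, t))) + e) * (t' - t).
Proof.
move=> e0; have [_ _ [mG2 _] wk] := V_grad.
apply: (@directional_increment R V G2 U snd fst (fun t w => (w, t))) => //.
- move=> a b ma mb; under eq_fun do rewrite mulrC.
  exact: measurable_tensor.
- move=> a b ma mb a0 b0; under eq_integral do rewrite mulrC.
  by rewrite muleC; exact: integral_tensor.
- move=> a b M sa sb a0 b0.
  have [_ +] := wk _ (test_fun_tensor b a M sb sa b0 a0).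
  rewrite dy_tensor => [h||x].
  + under eq_integral do rewrite [X in _ * X]mulrC.
    by under [in RHS]eq_integral do rewrite [X in _ * X]mulrC.
  + by move=> x; have [] := sb 1.
  + by have [] := sa 1.
- by move=> t1 w1 ? /(continuous2_le V (w1, t1) _ V_cont)[r r0 h]; exists r => // z ? ?; exact: h.
- by move=> t1 w1 ? /(continuous2_le U (w1, t1) _ U_cont)[r r0 h]; exists r => // z ? ?; exact: h.
- apply: (ae_sub (@mu2 R) _ _ _ G_le) => z; rewrite powV; apply: le_trans.
  by rewrite -sqrtr_sqr ler_wsqrtr// lerDr sqr_ge0.
- by move=> z; rewrite mulr_ge0 ?mulr_ge0// ltW.
Qed.

End dini_sqrt.

(** * Right Dini bounds for square roots and products *)

Section dini.
Context {R : realType}.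
Implicit Types v f : R -> R.

(** The chain rule is replaced by dividing the increment of [v] by [sqrt (v y) + sqrt (v x)], which
    tends to [2 sqrt (v x)]; this turns [C v^(3/2)] into [C / 2 v]. *)
Lemma sqrt_dini v (C x : R) : (forall y, 0 < v y) -> continuous v -> 
  (forall e, 0 < e -> exists2 r, 0 < r & forall y, x < y -> y < x + r ->
    `|v y - v x| <= (C * (v x * Num.sqrt (v x)) + e) * (y - x)) ->
  forall e, 0 < e -> \forall y \near x^'+,
    `|Num.sqrt (v y) - Num.sqrt (v x)| <= (C / 2 * v x + e) * (y - x).
Proof.
move=> v0 cv hv e e0.
pose s y := Num.sqrt (v y).
have s0 y : 0 < s y by rewrite sqrtr_gt0.
have ss y : s y * s y = v y by rewrite -expr2 sqr_sqrtr// ltW.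
have cs : continuous s.
  move=> y; apply: (@continuous_comp _ _ _ v (@Num.sqrt R)); first exact: cv.
  exact: sqrt_continuous.
(* The slack [e * s x] is half of the [2 e s x] available in the limit, so the comparison at [x] is
   strict and persists nearby. *)
have [r r0 hr] := hv (e * s x) (mulr_gt0 e0 (s0 x)).
have h1 : \forall y \near x^'+, C * (v x * s x) + e * s x < (C / 2 * v x + e) * (s y + s x).
  have h : (C / 2 * v x + e) * (s y + s x) @[y --> x] --> (C / 2 * v x + e) * (s x + s x).
    apply: cvgM; first exact: cvg_cst.
    by apply: cvgD; [exact: cs|exact: cvg_cst].
  apply: cvg_within; apply: (cvgr_gt _ h).
  have := mulr_gt0 e0 (s0 x); lra.
near=> y.
have xy : x < y by near: y; exact: nbhs_right_gt.
have yr : y < x + r by near: y; apply: nbhs_right_lt; rewrite ltrDl.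
have sp : 0 < s y + s x by rewrite addr_gt0.
rewrite -/(s y) -/(s x) -(ler_pM2r sp) -{1}(gtr0_norm sp) -normrM.
have -> : (s y - s x) * (s y + s x) = v y - v x by rewrite -!ss; ring.
apply: (le_trans (hr y xy yr)).
rewrite mulrAC ler_wpM2r ?subr_ge0 ?(ltW xy)// ltW//.
by near: y.
Unshelve. all: by end_near. Qed.

(** A product rule in which one factor has only a Dini bound. The increment is split with [v] taken
    at [y] and [f] at [x], so the continuity of [v] is what controls the first term. *)
Lemma mul_dini v f f' (L x : R) : 0 <= L -> continuous v -> 0 < v x ->
  is_derive x (1:R) f (f' x) ->
  (forall e, 0 < e -> \forall y \near x^'+, `|v y - v x| <= (L + e) * (y - x)) ->
  forall e, 0 < e -> \forall y \near x^'+,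
    `|v y * f y - v x * f x| <= (v x * `|f' x| + L * `|f x| + e) * (y - x).
Proof.
move=> L0 cv v0 df hv e e0.
(* Each use of [e1] or [e2] costs at most [e / 4], and there are three such quarters with the
   variation of [v]; the [+ 1] allows [f x = 0]. *)
pose e1 := e / (4 * v x); pose e2 := e / (4 * (`|f x| + 1)).
have fx1 : 0 < `|f x| + 1 by rewrite ltr_wpDl.
have e10 : 0 < e1 by rewrite divr_gt0// mulr_gt0.
have e20 : 0 < e2 by rewrite divr_gt0// mulr_gt0.
have h1 : \forall y \near x^'+, `|v y| * (`|f' x| + e1) < v x * (`|f' x| + e1) + e / 4.
  have h : `|v y| * (`|f' x| + e1) @[y --> x] --> `|v x| * (`|f' x| + e1).
    apply: cvgM; last exact: cvg_cst.
    by apply: cvg_norm; exact: cv.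
  apply: cvg_within; apply: (cvgr_lt _ h).
  by rewrite (gtr0_norm v0) ltrDl divr_gt0.
have h2 : \forall y \near x^'+, `|f y - f x| <= (`|f' x| + e1) * (y - x).
  have hd : h^-1 *: (f (h + x) - f x) @[h --> 0^'] --> f' x.
    have [d <-] := df.
    have : h^-1 *: ((f \o shift x) (h *: (1:R)) - f x) @[h --> 0^'] --> 'D_1 f x by exact: d.
    by under eq_fun do rewrite /= [_%:A]mulr1.
  have /cvgrPdist_le /(_ e1 e10) := hd.
  rewrite /dnbhs /within/= => /nbhs_ballP[q /= q0 hq].
  near=> y.
  have xy : x < y by near: y; exact: nbhs_right_gt.
  have yq : y < x + q by near: y; apply: nbhs_right_lt; rewrite ltrDl.
  have yx0 : 0 < y - x by rewrite subr_gt0.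
  have := hq (y - x); rewrite /ball/= sub0r normrN (gtr0_norm yx0) ltrBlDl.
  move=> /(_ yq); rewrite gt_eqF// => /(_ isT).
  rewrite subrK /GRing.scale/= => h.
  rewrite -ler_pdivrMr// -[X in _ / X](gtr0_norm yx0) -normfV -normrM mulrC.
  rewrite -lerBlDl (le_trans _ h)// (le_trans (lerB_dist _ _))//.
  by rewrite distrC.
have h3 := hv e2 e20.
near=> y.
have xy : x < y by near: y; exact: nbhs_right_gt.
have yx0 : 0 < y - x by rewrite subr_gt0.
have -> : v y * f y - v x * f x = v y * (f y - f x) + f x * (v y - v x) by ring.
rewrite (le_trans (ler_normD _ _))// !normrM.
have a1 : `|v y| * `|f y - f x| <= (v x * `|f' x| + e / 4 + e / 4) * (y - x).
  apply: (@le_trans _ _ (`|v y| * ((`|f' x| + e1) * (y - x)))).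
    by rewrite ler_wpM2l//; near: y.
  rewrite mulrA ler_pM2r//.
  have -> : v x * `|f' x| + e / 4 + e / 4 = v x * (`|f' x| + e1) + e / 4.
    by rewrite /e1; field; rewrite gt_eqF.
  by rewrite ltW//; near: y.
have a2 : `|f x| * `|v y - v x| <= (L * `|f x| + e / 4) * (y - x).
  apply: (@le_trans _ _ (`|f x| * ((L + e2) * (y - x)))).
    by rewrite ler_wpM2l//; near: y.
  rewrite mulrA ler_pM2r// mulrDr (mulrC L) lerD2l /e2 mulrA ler_pdivrMr ?mulr_gt0//.
  have := normr_ge0 (f x) => fx0.
  have := mulr_ge0 (ltW e0) fx0.
  lra.
apply: (le_trans (lerD a1 a2)).
rewrite -mulrDl ler_pM2r//; lra.
Unshelve. all: by end_near. Qed.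

End dini.

(** * Sobolev inequality on a square *)

Section dini_integral.
Context {R : realType}.
Local Notation leb := (@lebesgue_measure R).
Implicit Types F h H : R -> R.

(** Continuous induction. The supremum [c] of the points where the bound holds with slack
    [e (x - a)] satisfies it by continuity; if [c < b], the local bounds at [c] carry it strictly
    beyond [c]. [F] need not be differentiable. *)
Lemma dini_le_primitive F h H (a b : R) : a <= b -> continuous F ->
  (forall x, a <= x -> x <= b -> is_derive x (1:R) H (h x)) ->
  (forall x, a <= x -> x < b -> forall e, 0 < e -> \forall y \near x^'+,
    `|F y - F x| <= (h x + e) * (y - x)) ->
  `|F b - F a| <= H b - H a.
Proof.
move=> ab cF dH hF.
suff suf e : 0 < e -> `|F b - F a| <= H b - H a + e * (b - a).
  apply/ler_addgt0Pr => e e0.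
  have [ab'|] := ltP a b; last first.
    by move=> ba; have -> : b = a by [apply/eqP; rewrite eq_le ba ab]; rewrite !subrr normr0 add0r ltW.
  have := suf (e / (b - a)); rewrite divr_gt0 ?subr_gt0// => /(_ isT).
  by rewrite divfK// gt_eqF// subr_gt0.
move=> e0.
pose g x := H x - H a + e * (x - a) - `|F x - F a|.
pose A := [set x | a <= x <= b /\ 0 <= g x].
have Aa : A a by split; rewrite ?lexx ?ab// /g !subrr mulr0 addr0 normr0 subrr.
have ubA : has_ubound A by exists b => x [/andP[]].
have cH x : a <= x -> x <= b -> {for x, continuous H}.
  move=> ax xb; apply: differentiable_continuous; apply/derivable1_diffP.
  by have [] := dH x ax xb.
set c := sup A.
have ac : a <= c by exact: ub_le_sup.
have cb : c <= b by apply: ge_sup; [exists a|move=> x [/andP[]]].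
have cg : {for c, continuous g}.
  apply: cvgB.
    apply: cvgD; first by apply: cvgB; [exact: cH|exact: cvg_cst].
    by apply: cvgM; [exact: cvg_cst|apply: cvgB; [exact: cvg_id|exact: cvg_cst]].
  by apply: cvg_norm; apply: cvgB; [exact: cF|exact: cvg_cst].
have gc : 0 <= g c.
  rewrite leNgt; apply/negP => gc0.
  have : \forall y \near c, g y < 0 by exact: (cvgr_lt _ cg).
  move=> /(closure_sup (ex_intro _ a Aa) ubA)[y [[_ gy] /=]].
  by rewrite ltNge gy.
suff cbE : c = b by move: gc; rewrite cbE /g subr_ge0.
apply/eqP; rewrite eq_le cb leNgt; apply/negP => {cb}cb.
(* Half of the slack pays for the increment of [F], the other half for the first-order expansion of
   [H]. *)
have e2 : 0 < e / 2 by rewrite divr_gt0.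
have h1 := hF c ac cb _ e2.
have h2 : \forall y \near c^'+, (h c - e / 2) * (y - c) <= H y - H c.
  have [d dE] := dH c ac (ltW cb).
  have hd : h0^-1 *: (H (h0 + c) - H c) @[h0 --> 0^'] --> h c.
    rewrite -dE.
    have : h0^-1 *: ((H \o shift c) (h0 *: (1:R)) - H c) @[h0 --> 0^'] --> 'D_1 H c by exact: d.
    by under eq_fun do rewrite /= [_%:A]mulr1.
  have /cvgrPdist_le /(_ _ e2) := hd.
  rewrite /dnbhs /within/= => /nbhs_ballP[q /= q0 hq].
  near=> y.
  have xy : c < y by near: y; exact: nbhs_right_gt.
  have yq : y < c + q by near: y; apply: nbhs_right_lt; rewrite ltrDl.
  have yx0 : 0 < y - c by rewrite subr_gt0.
  have := hq (y - c); rewrite /ball/= sub0r normrN (gtr0_norm yx0) ltrBlDl.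
  move=> /(_ yq); rewrite gt_eqF// => /(_ isT).
  rewrite subrK /GRing.scale/= => hh.
  rewrite -ler_pdivlMr// mulrC.
  by have := ler_norm (h c - (y - c)^-1 * (H y - H c)) => hh2; lra.
have h3 : \forall y \near c^'+, A y.
  near=> y.
  have xy : c < y by near: y; exact: nbhs_right_gt.
  have yb : y < b by near: y; exact: nbhs_right_lt.
  split; first by rewrite (le_trans ac (ltW xy)) ltW.
  have k1 : `|F y - F c| <= (h c + e / 2) * (y - c) by near: y.
  have k2 : (h c - e / 2) * (y - c) <= H y - H c by near: y.
  have k3 : `|F y - F a| <= `|F y - F c| + `|F c - F a|.
    by rewrite (le_trans _ (ler_normD _ _))// addrA subrK.
  move: gc; rewrite /g; lra.
near c^'+ => y.
have Ay : A y by near: y.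
have : y <= c by exact: ub_le_sup.
by apply/negP; rewrite -ltNge; near: y; exact: nbhs_right_gt.
Unshelve. all: by end_near. Qed.

Lemma dini_le_integral F h (a b : R) : a < b -> continuous F -> continuous h ->
  (forall x e, 0 < e -> \forall y \near x^'+,
    `|F y - F x| <= (h x + e) * (y - x)) ->
  (`|F b - F a|%:E <= \int[leb]_(x in `[a, b]) (h x)%:E)%E.
Proof.
move=> ab cF ch hF.
(* Starting the primitive at [a - 1], and working up to [b + 1], makes it differentiable from both
   sides at [a] and [b]. *)
pose H x := (\int[leb]_(t in [set` `[a - 1, x]]) (h t))%R.
have dH x : a <= x -> x <= b -> is_derive x (1:R) H (h x).
  move=> ax xb.
  have := @continuous_FTC1_closed R h (a - 1) x (b + 1).
  move=> /(_ _ _ _ (ch x)) [].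
  - lra.
  - apply: continuous_compact_integrable; first exact: segment_compact.
    exact: continuous_subspaceT.
  - lra.
  - by move=> d; rewrite derive1E => hd; apply: DeriveDef.
rewrite (@continuous_FTC2 _ _ H)//.
- rewrite -EFinB lee_fin; apply: (@dini_le_primitive F h) => //; first exact: ltW.
  by move=> *; exact: hF.
- exact: continuous_subspaceT.
- have cH x : a <= x -> x <= b -> {for x, continuous H}.
    move=> ax xb; apply: differentiable_continuous; apply/derivable1_diffP.
    by have [] := dH x ax xb.
  split.
  + by move=> x; rewrite in_itv/= => /andP[ax xb]; have [] := dH x (ltW ax) (ltW xb).
  + by apply: cvg_at_right_filter; apply: cH => //; exact: ltW.
  + by apply: cvg_at_left_filter; apply: cH => //; exact: ltW.
- move=> x; rewrite in_itv/= => /andP[ax xb]; rewrite derive1E.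
  by have [_ ->] := dH x (ltW ax) (ltW xb).
Qed.

(** The embedding of [W^{1,1}] into bounded functions on an interval: compare [F x] with [F t] and
    average over [t]. The interval is half open so that the squares built from it tile the plane
    without overlap. *)
Lemma dini_le_average F h (a l x : R) : 0 < l -> continuous F -> continuous h ->
  (forall x, 0 <= h x) ->
  (forall x e, 0 < e -> \forall y \near x^'+,
    `|F y - F x| <= (h x + e) * (y - x)) ->
  a <= x -> x < a + l ->
  (`|F x|%:E <= \int[leb]_(t in `[a, (a + l)%R[) (l^-1 * `|F t| + h t)%:E)%E.
Proof.
move=> l0 cF ch h0 hF ax xl.
set I := `[a, a + l[%classic.
have mI : measurable I by exact: measurable_itv.
have mF : measurable_fun setT F by exact: continuous_measurable_fun.
have mh : measurable_fun setT h by exact: continuous_measurable_fun.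
have mnF : measurable_fun setT (fun t => `|F t|) by exact: measurableT_comp.
have lI : (leb I = l%:E)%E.
  rewrite /I lebesgue_measure_itv/= lte_fin ltrDl l0 -EFinB; congr (_%:E); lra.
set J := (\int[leb]_(t in I) (h t)%:E)%E.
have J0 : (0 <= J)%E by apply: integral_ge0 => t _; rewrite lee_fin.
have key u v : I u -> I v -> u < v -> (`|F v - F u|%:E <= J)%E.
  move=> Iu Iv uv; apply: (le_trans (dini_le_integral F h u v uv cF ch hF)).
  apply: ge0_subset_integral => //.
  - by apply/measurable_EFinP; exact: measurable_funTS.
  - by move=> t _; rewrite lee_fin.
  - move=> t /=; rewrite in_itv/= => /andP[ut tv].
    move: Iu Iv; rewrite /I/= !in_itv/= => /andP[au _] /andP[_ vl].
    by rewrite (le_trans au ut) (le_lt_trans tv vl).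
have Ix : I x by rewrite /I/= in_itv/= ax xl.
have bnd t : I t -> (`|F x|%:E <= `|F t|%:E + J)%E.
  move=> It.
  have hh : (`|F x - F t|%:E <= J)%E.
    have [xt|tx|->] := ltgtP x t.
    - by rewrite distrC; exact: key.
    - exact: key.
    - by rewrite subrr normr0.
  apply: (@le_trans _ _ (`|F t|%:E + `|F x - F t|%:E)%E); last by rewrite leeD2l.
  by rewrite -EFinD lee_fin -{1}(subrK (F t) (F x)) addrC ler_normD.
rewrite (integral_realD leb I (fun t => l^-1 * `|F t|) h)//; last 3 first.
- by apply: measurable_funM => //; exact: measurable_funTS.
- exact: measurable_funTS.
- by move=> t _; rewrite mulr_ge0// invr_ge0 ltW.
rewrite integral_realZ//; last 2 first.
- exact: measurable_funTS.
- by rewrite invr_ge0 ltW.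
rewrite -/J.
have mEF : measurable_fun I (fun t => `|F t|%:E).
  by apply/measurable_EFinP; exact: measurable_funTS.
have : (l%:E * `|F x|%:E <= \int[leb]_(t in I) `|F t|%:E + J * l%:E)%E.
  rewrite -lI muleC -(@integral_cst _ _ _ leb I mI) -(@integral_cst _ _ _ leb I mI J).
  rewrite -ge0_integralD//.
  apply: ge0_le_integral => //; first by move=> t _; rewrite lee_fin.
  exact: (emeasurable_funD mEF).
move=> hl.
have il0 : (0 <= (l^-1)%:E)%E by rewrite lee_fin invr_ge0 ltW.
have := lee_wpmul2l il0 hl.
rewrite muleA -(EFinM l^-1 l) mulVf ?gt_eqF// mul1e ge0_muleDr//; last 2 first.
- by apply: integral_ge0 => t _; rewrite lee_fin.
- by rewrite mule_ge0// lee_fin ltW.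
by rewrite (muleC J) muleA -EFinM mulVf ?gt_eqF// mul1e.
Qed.

End dini_integral.

(** * Tonelli and Gagliardo on a rectangle *)

Section cell.
Context {R : realType}.
Local Notation leb := (@lebesgue_measure R).
Variables (I J : set R).
Hypotheses (mI : measurable I) (mJ : measurable J).
Let Q : set (pt R) := I `*` J.

Lemma measurable_cell : measurable (I `*` J : set (pt R)).
Proof. exact: measurableX. Qed.

Let patch_cell (f : pt R -> \bar R) x y :
  (f \_ Q) (x, y) = ((fun x => (fun y => f (x, y)) \_ J y) \_ I) x.
Proof.
rewrite !patchE; case: (boolP ((x, y) \in Q)) => [/set_mem[/= Ix Jy]|].
  by rewrite !mem_set.
rewrite notin_setE => h; case: ifPn => //; rewrite inE => Ix.
by rewrite ifN// notin_setE => Jy; apply: h; split.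
Qed.

Lemma tonelli_cell1 (f : pt R -> \bar R) : measurable_fun [set: pt R] f ->
  (forall z, (0 <= f z)%E) ->
  (\int[@mu2 R]_(z in Q) f z = \int[leb]_(x in I) \int[leb]_(y in J) f (x, y))%E.
Proof.
move=> mf f0; rewrite integral_mkcond (tonelli1 (f \_ Q)); last 2 first.
- by apply/(measurable_restrictT _ measurable_cell); exact: measurable_funTS.
- by move=> z; apply: erestrict_ge0 => ? _.
rewrite [RHS]integral_mkcond; apply: eq_integral => x _.
rewrite patchE; case: ifPn => xI.
  rewrite [RHS]integral_mkcond; apply: eq_integral => y _.
  by rewrite patch_cell patchE xI.
by under eq_integral do rewrite patch_cell patchE (negbTE xI); rewrite integral0.
Qed.

Lemma tonelli_cell2 (f : pt R -> \bar R) : measurable_fun [set: pt R] f ->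
  (forall z, (0 <= f z)%E) ->
  (\int[@mu2 R]_(z in Q) f z = \int[leb]_(y in J) \int[leb]_(x in I) f (x, y))%E.
Proof.
move=> mf f0; rewrite integral_mkcond (tonelli2 (f \_ Q)); last 2 first.
- by apply/(measurable_restrictT _ measurable_cell); exact: measurable_funTS.
- by move=> z; apply: erestrict_ge0 => ? _.
rewrite [RHS]integral_mkcond; apply: eq_integral => y _.
rewrite patchE; case: ifPn => yJ.
  rewrite [RHS]integral_mkcond; apply: eq_integral => x _.
  by rewrite patch_cell !patchE yJ.
under eq_integral do rewrite patch_cell !patchE (negbTE yJ) if_same.
by rewrite integral0.
Qed.

Lemma measurable_slice1 (f : pt R -> \bar R) : measurable_fun [set: pt R] f ->
  (forall z, (0 <= f z)%E) ->
  measurable_fun setT (fun x => \int[leb]_(y in J) f (x, y))%E.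
Proof.
move=> mf f0.
have mg : measurable_fun [set: pt R] (f \_ (setT `*` J)).
  by apply/(measurable_restrictT _ (measurableX _ _)); rewrite ?measurableT//; exact: measurable_funTS.
have g0 z : (0 <= (f \_ (setT `*` J)) z)%E by apply: erestrict_ge0 => ? _.
have := @measurable_fun_fubini_tonelli_F _ _ _ _ R leb (f \_ (setT `*` J)) mg g0.
congr measurable_fun; apply/funext => x; rewrite /fubini_F [RHS]integral_mkcond.
apply: eq_integral => y _; rewrite !patchE; congr (if _ then _ else _).
by rewrite in_setX in_setT.
Qed.

Lemma measurable_slice2 (f : pt R -> \bar R) : measurable_fun [set: pt R] f ->
  (forall z, (0 <= f z)%E) ->
  measurable_fun setT (fun y => \int[leb]_(x in I) f (x, y))%E.
Proof.
move=> mf f0.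
have mg : measurable_fun [set: pt R] (f \_ (I `*` setT)).
  by apply/(measurable_restrictT _ (measurableX _ _)); rewrite ?measurableT//; exact: measurable_funTS.
have g0 z : (0 <= (f \_ (I `*` setT)) z)%E by apply: erestrict_ge0 => ? _.
have := @measurable_fun_fubini_tonelli_G _ _ _ _ R leb (f \_ (I `*` setT)) mg g0.
congr measurable_fun; apply/funext => y; rewrite /fubini_G [RHS]integral_mkcond.
apply: eq_integral => x _; rewrite !patchE; congr (if _ then _ else _).
by rewrite in_setX in_setT andbT.
Qed.

(* Gagliardo's argument: the two one-dimensional bounds separate variables. *)
Lemma gagliardo_cell (W E1 E2 : pt R -> R) :
  measurable_fun [set: pt R] W -> measurable_fun [set: pt R] E1 ->
  measurable_fun [set: pt R] E2 -> (forall z, 0 <= E1 z) -> (forall z, 0 <= E2 z) ->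
  (forall x y, I x -> J y ->
    (`|W (x, y)|%:E <= \int[leb]_(t in I) (E1 (t, y))%:E)%E) ->
  (forall x y, I x -> J y ->
    (`|W (x, y)|%:E <= \int[leb]_(t in J) (E2 (x, t))%:E)%E) ->
  (\int[@mu2 R]_(z in Q) (W z ^+ 2)%:E <=
   (\int[@mu2 R]_(z in Q) (E1 z)%:E) * (\int[@mu2 R]_(z in Q) (E2 z)%:E))%E.
Proof.
move=> mW mE1 mE2 E10 E20 W1 W2.
have mEE1 : measurable_fun [set: pt R] (EFin \o E1) by exact/measurable_EFinP.
have mEE2 : measurable_fun [set: pt R] (EFin \o E2) by exact/measurable_EFinP.
have EE10 z : (0 <= (EFin \o E1) z)%E by rewrite lee_fin.
have EE20 z : (0 <= (EFin \o E2) z)%E by rewrite lee_fin.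
have mW2 : measurable_fun [set: pt R] (fun z => (W z ^+ 2)%:E).
  by apply/measurable_EFinP; exact: measurable_funX.
rewrite (tonelli_cell1 (fun z => (W z ^+ 2)%:E))//; last first.
  by move=> z; rewrite lee_fin sqr_ge0.
rewrite (tonelli_cell2 (EFin \o E1))// (tonelli_cell1 (EFin \o E2))//.
set a := fun y => (\int[leb]_(x in I) (EFin \o E1) (x, y))%E.
set b := fun x => (\int[leb]_(y in J) (EFin \o E2) (x, y))%E.
have ma : measurable_fun setT a by exact: measurable_slice2.
have mb : measurable_fun setT b by exact: measurable_slice1.
have a0 y : (0 <= a y)%E by apply: integral_ge0 => ? _.
have b0 y : (0 <= b y)%E by apply: integral_ge0 => ? _.
have mWx x : measurable_fun setT (fun y => (W (x, y) ^+ 2)%:E).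
  exact: (measurableT_comp mW2 (measurable_pair1 x)).
have A0 : (0 <= \int[leb]_(y in J) a y)%E by apply: integral_ge0 => ? _; exact: a0.
have eb : (\int[leb]_(x in I) (b x * \int[leb]_(y in J) a y) =
    (\int[leb]_(x in I) b x) * \int[leb]_(y in J) a y)%E.
  by apply: ge0_integralZr => //; exact: (measurable_funTS mb).
rewrite muleC -[leRHS]eb.
apply: ge0_le_integral => //.
- by move=> x _; apply: integral_ge0 => y _; rewrite lee_fin sqr_ge0.
- apply: measurable_funTS; apply: (measurable_slice1 (fun z => (W z ^+ 2)%:E)) => //.
  by move=> z; rewrite lee_fin sqr_ge0.
- by apply: emeasurable_funM; [exact: (measurable_funTS mb)|exact: measurable_cst].
move=> x Ix.
have ea : (\int[leb]_(y in J) (b x * a y) = b x * \int[leb]_(y in J) a y)%E.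
  by apply: ge0_integralZl => //; exact: (measurable_funTS ma).
rewrite -ea; apply: ge0_le_integral => //.
- by move=> y _; rewrite lee_fin sqr_ge0.
- exact: (measurable_funTS (mWx x)).
- by apply: emeasurable_funM; [exact: measurable_cst|exact: (measurable_funTS ma)].
move=> y Jy; rewrite -real_normK ?num_real// expr2 EFinM.
by apply: lee_pmul; rewrite ?lee_fin//; [exact: W2|exact: W1].
Qed.

End cell.

(** * The Cauchy-Schwarz inequality in squared form *)

Section cauchy_schwarz.
Context {d} {T : measurableType d} {R : realType}.
Variable mu : {measure set T -> \bar R}.

(** Hölder with both exponents 2, applied to the functions extended by [0] outside [D]. The squared
    form holds in the extended reals, without roots or finiteness assumptions. *)
Lemma cauchy_schwarz_integral (D : set T) (f g : T -> R) : measurable D ->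
  measurable_fun setT f -> measurable_fun setT g ->
  (forall x, 0 <= f x) -> (forall x, 0 <= g x) ->
  ((\int[mu]_(x in D) (f x * g x)%:E) * (\int[mu]_(x in D) (f x * g x)%:E) <=
   (\int[mu]_(x in D) (f x ^+ 2)%:E) * (\int[mu]_(x in D) (g x ^+ 2)%:E))%E.
Proof.
move=> mD mf mg f0 g0.
have mfD : measurable_fun setT (f \_ D).
  by apply/(measurable_restrictT _ mD); exact: measurable_funTS.
have mgD : measurable_fun setT (g \_ D).
  by apply/(measurable_restrictT _ mD); exact: measurable_funTS.
have h2 : (2^-1 + 2^-1 = 1 :> R) by field.
have := hoelder mu mfD mgD (@ltr0n R 2) (@ltr0n R 2) h2.
have N2 (h : T -> R) : (forall x, 0 <= h x) ->
    ('N[mu]_2%:E[EFin \o (h \_ D)] * 'N[mu]_2%:E[EFin \o (h \_ D)] =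
     \int[mu]_(x in D) (h x ^+ 2)%:E)%E.
  move=> h0; have -> : ('N[mu]_2%:E[EFin \o (h \_ D)] * 'N[mu]_2%:E[EFin \o (h \_ D)]
      = 'N[mu]_2%:E[EFin \o (h \_ D)] `^ 2)%E.
    have := Lnorm_ge0 mu 2%:E (EFin \o (h \_ D)).
    case: ('N[mu]_2%:E[EFin \o (h \_ D)])%E => [r| |]//.
    - by rewrite lee_fin => r0; rewrite poweR_EFin powR_mulrn// expr2 EFinM.
    - by move=> _; rewrite poweRyr ?mulyy.
  rewrite poweR_Lnorm// [RHS]integral_mkcond; apply: eq_integral => x _.
  rewrite /= !patchE; case: ifPn => _.
    by rewrite ger0_norm// powR_mulrn.
  by rewrite normr0 powR0.
have -> : ('N[mu]_1[EFin \o ((f \_ D) \* (g \_ D))%R] =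
   \int[mu]_(x in D) (f x * g x)%:E)%E.
  rewrite Lnorm1 [RHS]integral_mkcond; apply: eq_integral => x _.
  rewrite /= !patchE; case: ifPn => _; first by rewrite ger0_norm// mulr_ge0.
  by rewrite mulr0 normr0.
move=> h; rewrite -!N2// muleACA.
have i0 : (0 <= \int[mu]_(x in D) (f x * g x)%:E)%E.
  by apply: integral_ge0 => x _; rewrite lee_fin mulr_ge0.
exact: lee_pmul.
Qed.

End cauchy_schwarz.

(** * The weighted inequality on one square *)

Section cell_inequality.
Context {R : realType}.
Local Notation leb := (@lebesgue_measure R).

Lemma is_derive_slice1 (f : pt R -> R^o) t w : differentiable f (t, w) ->
  is_derive t (1:R) (fun t => f (t, w)) (dx f (t, w)).
Proof.
move=> df.
have e : (fun h : R => h^-1 *: (((fun t => f (t, w)) \o shift t) (h *: (1:R)) - f (t, w)))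
   = (fun h : R => h^-1 *: ((f \o shift (t, w)) (h *: ((1, 0) : pt R)) - f (t, w))).
  apply/funext => h; congr (_ *: (f _ - _)); rewrite /=.
  by congr (_, _); rewrite /= ?[_ *: _]mulr0 ?add0r.
have d : derivable f (t, w) ((1, 0) : pt R) by exact: diff_derivable.
by apply: DeriveDef; rewrite /dx /derivable /derive e.
Qed.

Lemma is_derive_slice2 (f : pt R -> R^o) t w : differentiable f (w, t) ->
  is_derive t (1:R) (fun t => f (w, t)) (dy f (w, t)).
Proof.
move=> df.
have e : (fun h : R => h^-1 *: (((fun t => f (w, t)) \o shift t) (h *: (1:R)) - f (w, t)))
   = (fun h : R => h^-1 *: ((f \o shift (w, t)) (h *: ((0, 1) : pt R)) - f (w, t))).
  apply/funext => h; congr (_ *: (f _ - _)); rewrite /=.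
  by congr (_, _); rewrite /= ?[_ *: _]mulr0 ?add0r.
have d : derivable f (w, t) ((0, 1) : pt R) by exact: diff_derivable.
by apply: DeriveDef; rewrite /dy /derivable /derive e.
Qed.

Lemma slice1_continuous (f : pt R -> R) w : continuous f ->
  continuous (fun t => f (t, w)).
Proof.
move=> cf t; apply: (@continuous_comp _ _ _ (fun t : R => (t, w) : pt R) f); last exact: cf.
by apply: (@cvg_pair _ _ _ (nbhs t) (nbhs t) (nbhs w) _ _ _ id (fun=> w)); [exact: cvg_id|exact: cvg_cst].
Qed.

Lemma slice2_continuous (f : pt R -> R) w : continuous f ->
  continuous (fun t => f (w, t)).
Proof.
move=> cf t; apply: (@continuous_comp _ _ _ (fun t : R => (w, t) : pt R) f); last exact: cf.
by apply: (@cvg_pair _ _ _ (nbhs t) (nbhs w) (nbhs t) _ _ _ (fun=> w) id); [exact: cvg_cst|exact: cvg_id].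
Qed.

Lemma measurable_norm_real (f : pt R -> R) : measurable_fun [set: pt R] f ->
  measurable_fun [set: pt R] (fun z => `|f z|).
Proof. by move=> mf; exact: measurableT_comp. Qed.

Lemma sqrD_le (a b : R) : (a + b) ^+ 2 <= 2 * (a ^+ 2 + b ^+ 2).
Proof. by have := sqr_ge0 (a - b); nra. Qed.

Lemma lee_sqrD (x y : \bar R) : (0 <= x -> 0 <= y ->
  (x + y) * (x + y) <= 2%:E * (x * x) + 2%:E * (y * y))%E.
Proof.
case: x => [x| |]; case: y => [y| |]//.
- rewrite !lee_fin => x0 y0; have := sqr_ge0 (x - y); nra.
- by move=> x0 _; rewrite addey// mulyy gt0_muley ?lte_fin// addey ?leey// -!EFinM.
- by move=> _ y0; rewrite addye// mulyy gt0_muley ?lte_fin// addye ?leey// -!EFinM.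
- by move=> _ _; rewrite addye// mulyy gt0_muley ?lte_fin// addye ?leey.
Qed.

(** Origin of the constant: squaring the sum gives [2 N^2 x^2 + 2 K^2 y^2], and the bound on [x^2]
    brings a further factor 2 to the first term. The extended reals are kept because the integrals
    are not known to be finite. *)
Lemma lee_sqr_linear (x y A G : \bar R) (N K : R) : 0 <= N -> 0 <= K ->
  (0 <= x -> 0 <= y -> 0 <= A * G -> x * x <= A * (2%:E * G) ->
  (N%:E * x + K%:E * y) * (N%:E * x + K%:E * y) <=
  (4 * N ^+ 2 + 2 * K ^+ 2)%:E * (A * G + y * y))%E.
Proof.
move=> N0 K0 x0 y0 AG0 xx.
apply: (le_trans (lee_sqrD _ _ _ _)); [by rewrite mule_ge0|by rewrite mule_ge0|].
rewrite [leRHS]ge0_muleDr//; last by rewrite mule_ge0.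
apply: leeD; last first.
  rewrite (muleACA K%:E) -(EFinM K K) (muleA 2%:E) -(EFinM 2).
  rewrite lee_wpmul2r ?mule_ge0// lee_fin.
  by rewrite -expr2 lerDr mulr_ge0// sqr_ge0.
rewrite (muleACA N%:E) -(EFinM N N) (muleA 2%:E) -(EFinM 2).
apply: (le_trans (lee_wpmul2l _ xx)).
  by rewrite lee_fin mulr_ge0// mulr_ge0.
rewrite (muleCA A) (muleA _ 2%:E) -(EFinM _ 2) lee_wpmul2r//.
rewrite lee_fin -expr2.
have := sqr_ge0 K; lra.
Qed.

Variables (V : pt R -> R) (C c : R).
Hypothesis V_cont : continuous V.
Hypothesis c0 : 0 < c.
Hypothesis V_ge : forall z, c <= V z.
Hypothesis C0 : 0 < C.
Hypothesis V_fst : forall t w e, 0 < e -> exists2 r, 0 < r &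
  forall t', t < t' -> t' < t + r ->
  `|V (t', w) - V (t, w)| <= (C * (V (t, w) * Num.sqrt (V (t, w))) + e) * (t' - t).
Hypothesis V_snd : forall t w e, 0 < e -> exists2 r, 0 < r &
  forall t', t < t' -> t' < t + r ->
  `|V (w, t') - V (w, t)| <= (C * (V (w, t) * Num.sqrt (V (w, t))) + e) * (t' - t).

Let V0 z : 0 < V z.
Proof. exact: lt_le_trans (V_ge z). Qed.

Let s z := Num.sqrt (V z).
Let s0 z : 0 < s z. Proof. by rewrite sqrtr_gt0. Qed.
Let ss z : s z * s z = V z. Proof. by rewrite -expr2 sqr_sqrtr// ltW. Qed.
Let cs : continuous s. Proof. exact: sqrtV_continuous. Qed.

(** The bound that [mul_dini] gives for [V^(1/2) p^(n+1)] along an axis; [p'] stands for either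
    partial derivative of [p]. *)
Let wderiv (p p' : pt R -> R) n z :=
  s z * `|n.+1%:R * p z ^+ n * p' z| + C / 2 * V z * `|p z ^+ n.+1|.

Let wderiv_ge0 p p' n z : 0 <= wderiv p p' n z.
Proof.
have hC : 0 <= C / 2 by rewrite divr_ge0// ltW.
by rewrite addr_ge0// mulr_ge0 ?mulr_ge0// ltW.
Qed.

Let wderiv_continuous p p' n : continuous p -> continuous p' ->
  continuous (wderiv p p' n).
Proof.
move=> cp cp' z.
have cpX k : p x ^+ k @[x --> z] --> p z ^+ k.
  by apply: (@continuous_comp _ _ _ p (fun u => u ^+ k)); [exact: cp|exact: exprn_continuous].
apply: cvgD.
  apply: cvgM; first exact: cs.
  apply: cvg_norm; apply: cvgM; last exact: cp'.
  by apply: cvgM; [exact: cvg_cst|exact: cpX].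
apply: cvgM; last by apply: cvg_norm; exact: cpX.
by apply: cvgM; [exact: cvg_cst|exact: V_cont].
Qed.

Let slice_dini (v f f' : R -> R) n :
  (forall t, 0 < v t) -> continuous v ->
  (forall t e, 0 < e -> exists2 r, 0 < r & forall t', t < t' -> t' < t + r ->
    `|v t' - v t| <= (C * (v t * Num.sqrt (v t)) + e) * (t' - t)) ->
  (forall t, is_derive t (1:R) f (f' t)) ->
  forall t e, 0 < e -> \forall y \near t^'+,
    `|Num.sqrt (v y) * f y ^+ n.+1 - Num.sqrt (v t) * f t ^+ n.+1| <=
    (Num.sqrt (v t) * `|n.+1%:R * f t ^+ n * f' t| + C / 2 * v t * `|f t ^+ n.+1| + e) * (y - t).
Proof.
move=> v0 cv hv df t e e0.
apply: (@mul_dini R (fun t => Num.sqrt (v t)) (fun t => f t ^+ n.+1)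
  (fun t => n.+1%:R * f t ^+ n * f' t)) => //.
- by rewrite mulr_ge0 ?divr_ge0// ltW.
- move=> y; apply: (@continuous_comp _ _ _ v (@Num.sqrt R)); first exact: cv.
  exact: sqrt_continuous.
- by rewrite sqrtr_gt0.
- have -> : (fun t => f t ^+ n.+1) = f ^+ n.+1 by rewrite exprfctE.
  exact: (is_deriveX n.+1 (df t)).
- by apply: sqrt_dini => // e1 e10; exact: hv.
Qed.

Variable p : pt R -> R.
Hypothesis p_C1 : @Ck R 1 p.

Let p_diff z : differentiable (p : pt R -> R^o) z. Proof. by case: p_C1. Qed.
Let cpx : continuous (dx p). Proof. by case: p_C1 => _ []. Qed.
Let cpy : continuous (dy p). Proof. by case: p_C1 => _ []. Qed.
Let cp : continuous p.
Proof. by move=> z; exact: differentiable_continuous. Qed.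

Variables (l a b : R) (n : nat).
Hypothesis l0 : 0 < l.
Let I := `[a, a + l[%classic.
Let J := `[b, b + l[%classic.
Let Q : set (pt R) := I `*` J.
(** The first term comes from the growth of [V^(1/2)], the second from the averaged term [l^-1 |W|]
    after [V^(1/2) <= V / sqrt c]. *)
Let K := C / 2 + l^-1 / Num.sqrt c.

Let W z := s z * p z ^+ n.+1.
Let E' (p' : pt R -> R) z := l^-1 * `|W z| + wderiv p p' n z.

Let cW : continuous W.
Proof.
move=> z; apply: cvgM; first exact: cs.
by apply: (@continuous_comp _ _ _ p (fun u => u ^+ n.+1)); [exact: cp|exact: exprn_continuous].
Qed.

Let E'_ge0 p' z : 0 <= E' p' z.
Proof. by rewrite addr_ge0// mulr_ge0// invr_ge0 ltW. Qed.

Let E'_measurable p' : continuous p' -> measurable_fun [set: pt R] (E' p').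
Proof.
move=> cp'; apply: continuous_measurable_fun2 => z; apply: cvgD; last exact: wderiv_continuous.
by apply: cvgM; [exact: cvg_cst|apply: cvg_norm; exact: cW].
Qed.

Let W_le1 x y : I x -> J y ->
  (`|W (x, y)|%:E <= \int[leb]_(t in I) (E' (dx p) (t, y))%:E)%E.
Proof.
rewrite /I/= in_itv/= => /andP[ax xl] _.
apply: (@dini_le_average R (fun t => W (t, y)) (fun t => wderiv p (dx p) n (t, y))) => //.
- exact: slice1_continuous.
- exact: (slice1_continuous _ y (wderiv_continuous _ _ n cp cpx)).
- apply: (slice_dini (fun t => V (t, y)) (fun t => p (t, y)) (fun t => dx p (t, y))) => //.
  + exact: slice1_continuous.
  + by move=> t e e0; exact: V_fst.
  + by move=> t; exact: is_derive_slice1.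
Qed.

Let W_le2 x y : I x -> J y ->
  (`|W (x, y)|%:E <= \int[leb]_(t in J) (E' (dy p) (x, t))%:E)%E.
Proof.
move=> _; rewrite /J/= in_itv/= => /andP[ax xl].
apply: (@dini_le_average R (fun t => W (x, t)) (fun t => wderiv p (dy p) n (x, t))) => //.
- exact: slice2_continuous.
- exact: (slice2_continuous _ x (wderiv_continuous _ _ n cp cpy)).
- apply: (slice_dini (fun t => V (x, t)) (fun t => p (x, t)) (fun t => dy p (x, t))) => //.
  + exact: slice2_continuous.
  + by move=> t e e0; exact: V_snd.
  + by move=> t; exact: is_derive_slice2.
Qed.

Let mI : measurable I. Proof. exact: measurable_itv. Qed.
Let mJ : measurable J. Proof. exact: measurable_itv. Qed.
Let mQ : measurable Q. Proof. exact: measurable_cell. Qed.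

(** A common majorant of the two partial derivatives: both factors of Gagliardo's product get the
    same bound, and the product becomes a square. *)
Let g z := `|dx p z| + `|dy p z|.
Let X z := s z * `|p z| ^+ n * g z.
Let Y z := V z * `|p z| ^+ n.+1.

Let E'_le p' z : `|p' z| <= g z -> E' p' z <= n.+1%:R * X z + K * Y z.
Proof.
move=> p'g; rewrite /E' /wderiv addrCA lerD//.
  rewrite /X !normrM normr_nat normrX [leRHS]mulrA.
  have -> : s z * (n.+1%:R * `|p z| ^+ n * `|p' z|) =
    n.+1%:R * (s z * `|p z| ^+ n) * `|p' z| by ring.
  by rewrite ler_wpM2l// mulr_ge0// mulr_ge0 ?exprn_ge0// ltW.
rewrite /W /Y normrM (gtr0_norm (s0 z)) normrX /K [leRHS]mulrDl addrC.
rewrite !mulrA lerD2l ler_wpM2r ?exprn_ge0//.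
rewrite -!mulrA ler_wpM2l ?invr_ge0 ?(ltW l0)//.
rewrite mulrC ler_pdivlMr ?sqrtr_gt0// -ss ler_pM2l//.
by rewrite ler_wsqrtr.
Qed.

Lemma cell_inequality :
  (\int[@mu2 R]_(z in Q) (V z * `|p z| ^+ (n.+1 * 2))%:E <=
   (4 * n.+1%:R ^+ 2 + 2 * K ^+ 2)%:E *
   ((\int[@mu2 R]_(z in Q) (V z * `|p z| ^+ (n * 2))%:E) *
    (\int[@mu2 R]_(z in Q) (dx p z ^+ 2 + dy p z ^+ 2)%:E) +
    (\int[@mu2 R]_(z in Q) (V z * `|p z| ^+ n.+1)%:E) *
    (\int[@mu2 R]_(z in Q) (V z * `|p z| ^+ n.+1)%:E)))%E.
Proof.
have ms : measurable_fun [set: pt R] s by exact: continuous_measurable_fun2.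
have mV : measurable_fun [set: pt R] V by exact: continuous_measurable_fun2.
have mp : measurable_fun [set: pt R] p by exact: continuous_measurable_fun2.
have mpx : measurable_fun [set: pt R] (dx p) by exact: (continuous_measurable_fun2 _ cpx).
have mpy : measurable_fun [set: pt R] (dy p) by exact: (continuous_measurable_fun2 _ cpy).
have mW : measurable_fun [set: pt R] W by exact: continuous_measurable_fun2.
have mnp k : measurable_fun [set: pt R] (fun z => `|p z| ^+ k).
  by apply: measurable_funX; exact: measurableT_comp.
have mg : measurable_fun [set: pt R] g.
  exact: (measurable_funD (measurable_norm_real _ mpx) (measurable_norm_real _ mpy)).
have mg2 := measurable_funD (measurable_funX 2 mpx) (measurable_funX 2 mpy).
have msp : measurable_fun [set: pt R] (fun z => s z * `|p z| ^+ n).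
  exact: measurable_funM.
have mX : measurable_fun [set: pt R] X by exact: measurable_funM.
have mY : measurable_fun [set: pt R] Y by exact: measurable_funM.
have g0 z : 0 <= g z by rewrite addr_ge0.
have sp0 z : 0 <= s z * `|p z| ^+ n by rewrite mulr_ge0 ?exprn_ge0// ltW.
have X0 z : 0 <= X z by rewrite mulr_ge0.
have Y0 z : 0 <= Y z by rewrite mulr_ge0 ?exprn_ge0// ltW.
have K0 : 0 <= K by rewrite addr_ge0 ?divr_ge0 ?invr_ge0 ?sqrtr_ge0// ltW.
have := gagliardo_cell I J mI mJ W (E' (dx p)) (E' (dy p)) mW
  (E'_measurable _ cpx) (E'_measurable _ cpy) (E'_ge0 _) (E'_ge0 _) W_le1 W_le2.
have -> : (\int[@mu2 R]_(z in I `*` J) (W z ^+ 2)%:E =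
    \int[@mu2 R]_(z in Q) (V z * `|p z| ^+ (n.+1 * 2))%:E)%E.
  apply: eq_integral => z _; congr (_%:E).
  by rewrite exprMn expr2 ss exprM -normrX real_normK ?num_real.
move=> h; apply: (le_trans h).
set iX := (\int[@mu2 R]_(z in Q) (X z)%:E)%E.
set iY := (\int[@mu2 R]_(z in Q) (Y z)%:E)%E.
have iX0 : (0 <= iX)%E by apply: integral_ge0 => z _; rewrite lee_fin.
have iY0 : (0 <= iY)%E by apply: integral_ge0 => z _; rewrite lee_fin.
have iE p' : continuous p' -> (forall z, `|p' z| <= g z) ->
    (\int[@mu2 R]_(z in Q) (E' p' z)%:E <= n.+1%:R%:E * iX + K%:E * iY)%E.
  move=> cp' p'g; rewrite -integral_realZ//; last exact: (measurable_funTS mX).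
  rewrite -integral_realZ//; last exact: (measurable_funTS mY).
  rewrite -integral_realD//; last 4 first.
  - by apply: measurable_funM => //; exact: (measurable_funTS mX).
  - by apply: measurable_funM => //; exact: (measurable_funTS mY).
  - by move=> z _; rewrite mulr_ge0.
  - by move=> z _; rewrite mulr_ge0.
  apply: le_integral_real => //.
  - exact: (measurable_funTS (E'_measurable _ cp')).
  - apply: measurable_funTS; apply: measurable_funD; exact: measurable_funM.
  - by move=> z _; exact: E'_le.
have pxg z : `|dx p z| <= g z by rewrite lerDl.
have pyg z : `|dy p z| <= g z by rewrite lerDr.
apply: (le_trans (lee_pmul _ _ (iE _ cpx pxg) (iE _ cpy pyg))).
- by apply: integral_ge0 => z _; rewrite lee_fin.
- by apply: integral_ge0 => z _; rewrite lee_fin.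
have AG0 : (0 <= (\int[@mu2 R]_(z in Q) (V z * `|p z| ^+ (n * 2))%:E) *
    \int[@mu2 R]_(z in Q) (dx p z ^+ 2 + dy p z ^+ 2)%:E)%E.
  apply: mule_ge0; apply: integral_ge0 => z _; rewrite lee_fin.
    by rewrite mulr_ge0 ?exprn_ge0// ltW.
  by rewrite addr_ge0 ?sqr_ge0.
(* Cauchy-Schwarz for [X] split as [V^(1/2) |p|^n] times [g]; the factor 2 comes from
   [g^2 <= 2 (dx p^2 + dy p^2)]. *)
have XX : (iX * iX <= (\int[@mu2 R]_(z in Q) (V z * `|p z| ^+ (n * 2))%:E) *
    (2%:E * \int[@mu2 R]_(z in Q) (dx p z ^+ 2 + dy p z ^+ 2)%:E))%E.
  apply: (le_trans (cauchy_schwarz_integral (@mu2 R) Q _ _ mQ msp mg sp0 g0)).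
  apply: lee_pmul.
  - by apply: integral_ge0 => z _; rewrite lee_fin sqr_ge0.
  - by apply: integral_ge0 => z _; rewrite lee_fin sqr_ge0.
  - rewrite le_eqVlt; apply/orP; left; apply/eqP; apply: eq_integral => z _.
    by congr (_%:E); rewrite exprMn expr2 ss exprM.
  - rewrite -integral_realZ//; last 2 first.
    + exact: (measurable_funTS mg2).
    + by move=> z _; rewrite addr_ge0 ?sqr_ge0.
    apply: le_integral_real => //.
    + by apply: measurable_funTS; exact: measurable_funX.
    + apply: measurable_funTS; apply: measurable_funM => //; exact: mg2.
    + by move=> z _; rewrite sqr_ge0.
    + move=> z _; rewrite /g -(real_normK (num_real (dx p z))).
      rewrite -(real_normK (num_real (dy p z))).
      exact: sqrD_le.
exact: lee_sqr_linear.
Qed.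

End cell_inequality.

(** * Bounds for test functions *)

Section grid.
Context {R : realType}.

Definition cell (l : R) (q : pt R) : set (pt R) :=
  `[q.1, q.1 + l[ `*` `[q.2, q.2 + l[.

Lemma measurable_cell_square l q : measurable (cell l q).
Proof. by apply: measurableX; exact: measurable_itv. Qed.

Lemma measurable_ball2 xi (e : R) : measurable (ball2 xi e).
Proof.
have mq : measurable_fun [set: pt R]
    (fun z : pt R => (z.1 - xi.1) ^+ 2 + (z.2 - xi.2) ^+ 2).
  apply: measurable_funD; apply: measurable_funX; apply: measurable_funB => //.
have := mq measurableT _ (@measurable_itv R `]-oo, e ^+ 2[); rewrite setTI.
by congr measurable; apply/seteqP; split => z /=; rewrite in_itv.
Qed.

(** Only finitely many squares are needed because test functions vanish outside a box. Their number
    depends on [M], but their side [l] does not, so estimates summed over them have constants free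
    of the support. *)
Lemma grid_cells (l M : R) : 0 < l -> exists cells : seq (pt R),
  (forall f : pt R -> R, measurable_fun [set: pt R] f -> (forall z, 0 <= f z) ->
    (\sum_(q <- cells) \int[@mu2 R]_(z in cell l q) (f z)%:E <=
     \int[@mu2 R]_z (f z)%:E)%E) /\
  (forall f : pt R -> R, measurable_fun [set: pt R] f -> (forall z, 0 <= f z) ->
    (forall z, M < `|z.1| \/ M < `|z.2| -> f z = 0) ->
    (\int[@mu2 R]_z (f z)%:E =
     \sum_(q <- cells) \int[@mu2 R]_(z in cell l q) (f z)%:E)%E).
Proof.
(* [M] may be negative, hence the absolute value. *)
move=> l0; pose N := Num.Def.archi_bound (`|M| / l).
have NM : `|M| < N%:R * l.
  by rewrite -ltr_pdivrMr//; apply: archi_boundP; rewrite divr_ge0// ltW.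
pose a (i : nat) : R := (i%:R - N%:R) * l.
pose s := iota 0 (N + N).
pose cells : seq (pt R) := [seq (a i, a j) | i <- s, j <- s].
have aS i : a i + l = (i.+1%:R - N%:R) * l by rewrite /a -natr1; ring.
(* Used in both orders, this comparison of indices yields the injectivity of [a] and the
   disjointness of the cells. *)
have a_eq x i j : a i <= x -> x < a j + l -> (i <= j)%N.
  move=> h1 h2; have := le_lt_trans h1 h2.
  by rewrite aS ltr_pM2r// ltrD2r ltr_nat ltnS.
have a_inj i j : a i = a j -> i = j.
  move=> aij; apply/eqP; rewrite eqn_leq.
  by rewrite (a_eq (a i) i j) ?aij ?ltrDl// (a_eq (a j) j i) -?aij ?ltrDl.
have uc : uniq cells.
  apply: allpairs_uniq; rewrite ?iota_uniq//.
  by move=> [i j] [i' j'] _ _ /= [/a_inj -> /a_inj ->].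
have tc : trivIset [set` cells] (cell l).
  move=> q q' /= /allpairsP[[i j] [_ _ ->]] /allpairsP[[i' j'] [_ _ ->]].
  move=> [[x y] [[/=]]]; rewrite !in_itv/= => /andP[x1 x2] /andP[y1 y2] [/=].
  rewrite !in_itv/= => /andP[x3 x4] /andP[y3 y4].
  have -> : i = i' by apply/eqP; rewrite eqn_leq (a_eq x i i')// (a_eq x i' i).
  by have -> : j = j' by apply/eqP; rewrite eqn_leq (a_eq y j j')// (a_eq y j' j).
have sum_eq (f : pt R -> R) : measurable_fun [set: pt R] f -> (forall z, 0 <= f z) ->
   (\int[@mu2 R]_(z in \big[setU/set0]_(q <- cells) cell l q) (f z)%:E =
     \sum_(q <- cells) \int[@mu2 R]_(z in cell l q) (f z)%:E)%E.
  move=> mf f0; apply: (@ge0_integral_bigsetU _ _ _ (@mu2 R)) => //.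
  - by move=> q; exact: measurable_cell_square.
  - by apply/measurable_EFinP; exact: (measurable_funTS mf).
  - by move=> z _; rewrite lee_fin.
have mD : measurable (\big[setU/set0]_(q <- cells) cell l q).
  by apply: bigsetU_measurable => q _; exact: measurable_cell_square.
exists cells; split => f mf f0.
  rewrite -sum_eq//; apply: ge0_subset_integral => //; first exact/measurable_EFinP.
  by move=> z _; rewrite lee_fin.
move=> fM; rewrite -sum_eq// [RHS]integral_mkcond; apply: eq_integral => z _.
rewrite patchE; case: ifPn => //; rewrite notin_setE => nz.
have [/fM ->//|h] := pselect (M < `|z.1| \/ M < `|z.2|).
exfalso; apply: nz; rewrite -bigcup_seq.
have inI (x : R) : `|x| <= M -> exists2 i, i \in s & a i <= x < a i + l.
  move=> xM; have xN : `|x| < N%:R * l by rewrite (le_lt_trans (le_trans xM (ler_norm M))).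
  have := xN; rewrite ltr_norml => /andP[x1 x2].
  have y0 : 0 <= x / l + N%:R.
    by rewrite -lerBlDr sub0r ler_pdivlMr// mulNr ltW.
  exists (Num.Def.trunc (x / l + N%:R)).
    rewrite mem_iota add0n /= -(ltr_nat R).
    have /andP[h1 _] := truncn_itv y0.
    rewrite (le_lt_trans h1)// natrD ltrD2r ltr_pdivrMr//.
  have /andP[h1 h2] := truncn_itv y0.
  rewrite aS /a -ler_pdivlMr// -ltr_pdivrMr//.
  by rewrite lerBlDr h1 ltrBrDr h2.
have [z1 z2] : `|z.1| <= M /\ `|z.2| <= M.
  by split; rewrite leNgt; apply/negP => ?; apply: h; [left|right].
have [i si hi] := inI _ z1; have [j sj hj] := inI _ z2.
exists (a i, a j); first by apply/allpairsP; exists (i, j).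
by split; rewrite /= in_itv.
Qed.

End grid.

(** * Smallness in the power 4 and boundedness in even powers *)

Section test_function_bounds.
Context {R : realType}.
Variables (V : pt R -> R) (C c r : R).
Hypothesis V_cont : continuous V.
Hypothesis c0 : 0 < c.
Hypothesis V_ge : forall z, c <= V z.
Hypothesis C0 : 0 < C.
Hypothesis r0 : 0 < r.
Hypothesis V_fst : forall t w e, 0 < e -> exists2 r, 0 < r &
  forall t', t < t' -> t' < t + r ->
  `|V (t', w) - V (t, w)| <= (C * (V (t, w) * Num.sqrt (V (t, w))) + e) * (t' - t).
Hypothesis V_snd : forall t w e, 0 < e -> exists2 r, 0 < r &
  forall t', t < t' -> t' < t + r ->
  `|V (w, t') - V (w, t)| <= (C * (V (w, t) * Num.sqrt (V (w, t))) + e) * (t' - t).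

Let V0 z : 0 < V z.
Proof. exact: lt_le_trans (V_ge z). Qed.

Let mV : measurable_fun [set: pt R] V.
Proof. exact: continuous_measurable_fun2. Qed.

Let A (p : pt R -> R) (k : nat) (D : set (pt R)) :=
  (\int[@mu2 R]_(z in D) (V z * `|p z| ^+ k)%:E)%E.
Let G (p : pt R -> R) (D : set (pt R)) :=
  (\int[@mu2 R]_(z in D) (dx p z ^+ 2 + dy p z ^+ 2)%:E)%E.

Let Vp_ge0 (p : pt R -> R) k z : 0 <= V z * `|p z| ^+ k.
Proof. by rewrite mulr_ge0 ?exprn_ge0// ltW. Qed.

Let A_ge0 p k D : (0 <= A p k D)%E.
Proof. by apply: integral_ge0 => z _; rewrite lee_fin. Qed.

Let G_ge0 p D : (0 <= G p D)%E.
Proof. by apply: integral_ge0 => z _; rewrite lee_fin addr_ge0 ?sqr_ge0. Qed.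

Section one_function.
Variable p : pt R -> R.
Hypothesis p_test : test_fun p.

Let p_C1 : @Ck R 1 p. Proof. by case: p_test => h _; exact: h. Qed.
Let mp : measurable_fun [set: pt R] p.
Proof. by apply: continuous_measurable_fun2; case: p_test => h _; exact: (h 0). Qed.
Let mpx : measurable_fun [set: pt R] (dx p).
Proof. by case: p_C1 => _ [cpx _]; exact: (continuous_measurable_fun2 _ cpx). Qed.
Let mpy : measurable_fun [set: pt R] (dy p).
Proof. by case: p_C1 => _ [_ cpy]; exact: (continuous_measurable_fun2 _ cpy). Qed.
Let mVp k : measurable_fun [set: pt R] (fun z => V z * `|p z| ^+ k).
Proof. by apply: measurable_funM => //; apply: measurable_funX; exact: measurableT_comp. Qed.
Let mG : measurable_fun [set: pt R] (fun z => dx p z ^+ 2 + dy p z ^+ 2).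
Proof. exact: (measurable_funD (measurable_funX 2 mpx) (measurable_funX 2 mpy)). Qed.

Lemma normV2_split : normV2 V p (dx p) (dy p) = (G p setT + A p 2 setT)%E.
Proof.
rewrite /normV2 -(integral_realD (@mu2 R) setT _ _ measurableT mG (mVp 2))//.
  by apply: eq_integral => z _; rewrite real_normK ?num_real.
by move=> z _; rewrite addr_ge0 ?sqr_ge0.
Qed.

(** The grid is chosen before the exponent [k]: one family of squares serves all the integrals that
    are summed together. *)
Lemma integral_exp_sum_cells n : exists cells : seq (pt R), [/\
  (A p (n.+1 * 2) setT <= \sum_(q <- cells)
    (4 * n.+1%:R ^+ 2 + 2 * (C / 2 + r^-1 / Num.sqrt c) ^+ 2)%:E *
    (A p (n * 2) (cell r q) * G p (cell r q) +
     A p n.+1 (cell r q) * A p n.+1 (cell r q)))%E,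
  (\sum_(q <- cells) G p (cell r q) <= G p setT)%E &
  forall k, (\sum_(q <- cells) A p k (cell r q) <= A p k setT)%E].
Proof.
have [_ [M pM]] := p_test.
have [cells [h1 h2]] := grid_cells r M r0.
exists cells; split.
- rewrite /A h2// => [|z /pM ->]; last by rewrite normr0 expr0n/= mulr0.
  by apply: lee_sum => q _; exact: cell_inequality.
- by apply: h1 => // z; rewrite addr_ge0 ?sqr_ge0.
- by move=> k; exact: h1.
Qed.

Let K n := 4 * n.+1%:R ^+ 2 + 2 * (C / 2 + r^-1 / Num.sqrt c) ^+ 2.
Let K0 n : 0 <= K n.
Proof. by apply: addr_ge0; apply: mulr_ge0 => //; exact: sqr_ge0. Qed.

(** In each product over a square, one factor is bounded by its integral over the plane and the
    other is summed over the grid. *)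
Lemma integral_exp_step n : (A p (n.+1 * 2) setT <= (K n)%:E *
  (A p (n * 2) setT * G p setT + A p n.+1 setT * A p n.+1 setT))%E.
Proof.
have [cells [h hG hA]] := integral_exp_sum_cells n.
apply: (le_trans h); rewrite -/(K n).
have sub k q : (A p k (cell r q) <= A p k setT)%E.
  have mE : measurable_fun [set: pt R] (fun z => (V z * `|p z| ^+ k)%:E).
    by apply/measurable_EFinP; exact: mVp.
  by apply: (@ge0_subset_integral _ _ _ (@mu2 R) _ _ (measurable_cell_square r q) measurableT _ mE) => // z _; rewrite lee_fin.
apply: (@le_trans _ _ (\sum_(q <- cells) (K n)%:E *
  (A p (n * 2) setT * G p (cell r q) + A p n.+1 setT * A p n.+1 (cell r q)))%E).
  apply: lee_sum => q _; rewrite lee_wpmul2l ?lee_fin//.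
  by apply: leeD; apply: lee_wpmul2r.
rewrite -ge0_sume_distrr => [|q _]; last by rewrite adde_ge0 ?mule_ge0.
rewrite lee_wpmul2l ?lee_fin// big_split/=.
rewrite -ge0_sume_distrr// -ge0_sume_distrr//.
by apply: leeD; rewrite lee_wpmul2l.
Qed.

(** Both products on a square contain the integral of [V p^2] there, which is at most [e]; the
    remaining factors add up to the norm. *)
Lemma integral_exp4_le (e : R) :
  (forall xi, (\int[@mu2 R]_(x in ball2 xi r) (V x * p x ^+ 2)%:E <= e%:E)%E) ->
  (A p 4 setT <= (K 1)%:E * (e%:E * normV2 V p (dx p) (dy p)))%E.
Proof.
move=> he; have [cells [h hG hA]] := integral_exp_sum_cells 1.
have e0 : 0 <= e.
  rewrite -lee_fin (le_trans _ (he 0))//; apply: integral_ge0 => z _.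
  by rewrite lee_fin mulr_ge0 ?sqr_ge0// ltW.
apply: (le_trans h); rewrite -/(K 1).
have sub q : (A p 2 (cell r q) <= e%:E)%E.
  (* A square of side [r] lies in the ball of radius [r] about its centre: squared distances are at
     most [r^2 / 2]. *)
  apply: le_trans (he (q.1 + r / 2, q.2 + r / 2)).
  rewrite [leRHS](_ : _ = A p 2 (ball2 (q.1 + r / 2, q.2 + r / 2) r)); last first.
    by apply: eq_integral => z _; rewrite real_normK ?num_real.
  apply: ge0_subset_integral => //.
  - exact: measurable_cell_square.
  - exact: measurable_ball2.
  - by apply/measurable_EFinP; exact: (measurable_funTS (mVp 2)).
  - by move=> z _; rewrite lee_fin.
  - move=> z [/=]; rewrite !in_itv/= => /andP[x1 x2] /andP[y1 y2].
    rewrite /ball2/=.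
    have b (u : R) : - (r / 2) <= u -> u <= r / 2 -> u ^+ 2 <= (r / 2) ^+ 2.
      by move=> u1 u2; rewrite -real_normK ?num_real// ler_sqr ?nnegrE ?ler_norml ?u1// divr_ge0// ltW.
    have h1 : (z.1 - (q.1 + r / 2)) ^+ 2 <= (r / 2) ^+ 2 by apply: b; lra.
    have h2 : (z.2 - (q.2 + r / 2)) ^+ 2 <= (r / 2) ^+ 2 by apply: b; lra.
    have h3 : 0 < r ^+ 2 by rewrite exprn_gt0.
    have h4 : (r / 2) ^+ 2 = r ^+ 2 / 4 by field.
    lra.
rewrite normV2_split.
apply: (@le_trans _ _ (\sum_(q <- cells) (K 1)%:E *
  (e%:E * G p (cell r q) + e%:E * A p 2 (cell r q)))%E).
  apply: lee_sum => q _; rewrite lee_wpmul2l ?lee_fin//.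
  by apply: leeD; apply: lee_wpmul2r => //; exact: sub.
have e0E : (0 <= e%:E)%E by rewrite lee_fin.
rewrite -ge0_sume_distrr => [|q _]; last by rewrite adde_ge0 ?mule_ge0.
rewrite lee_wpmul2l ?lee_fin// big_split/=.
rewrite -ge0_sume_distrr// -ge0_sume_distrr// ge0_muleDr//.
by apply: leeD; rewrite lee_wpmul2l.
Qed.

(** The exponent [n + 2] lies between 2 and [2n + 2]; this handles the squared term of
    [integral_exp_step], whose exponent may be odd. *)
Lemma integral_exp_interpolation n : (A p n.+2 setT <= A p 2 setT + A p (n.+1 * 2) setT)%E.
Proof.
rewrite -(integral_realD (@mu2 R) setT _ _ measurableT (mVp 2) (mVp (n.+1 * 2)))//.
apply: (le_integral_real (@mu2 R) setT _ _ measurableT (mVp _)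
  (measurable_funD (mVp 2) (mVp (n.+1 * 2)))) => // z _ /=.
rewrite -mulrDr ler_pM2l//.
have [t1|t1] := leP `|p z| 1.
  rewrite (@le_trans _ _ (`|p z| ^+ 2))// ?lerDl ?exprn_ge0//.
  by rewrite ler_wiXn2l.
rewrite (@le_trans _ _ (`|p z| ^+ (n.+1 * 2)))// ?lerDr ?exprn_ge0//.
by rewrite ler_weXn2l ?ltW// muln2 -addnn addSn addnS !ltnS leq_addr.
Qed.

End one_function.

(** The induction passes from the power [2n + 2] to [2n + 4], and [B] depends on [p] only through
    the bound [N] on its norm; this is what makes the estimate uniform along the sequence. *)
Lemma integral_exp_bounded n (N : R) : exists B : R, forall p, test_fun p ->
  (normV2 V p (dx p) (dy p) <= N%:E)%E -> (A p (n.+1 * 2) setT <= B%:E)%E.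
Proof.
elim: n => [|n [B hB]].
  exists N => p tp; rewrite normV2_split//; apply: le_trans.
  by rewrite leeDr.
exists ((4 * n.+2%:R ^+ 2 + 2 * (C / 2 + r^-1 / Num.sqrt c) ^+ 2) *
  (B * N + (N + B) * (N + B))) => p tp hN.
have AB := hB p tp hN.
move: (hN); rewrite normV2_split// => hN'.
have GN : (G p setT <= N%:E)%E by apply: le_trans hN'; rewrite leeDl.
have AN : (A p 2 setT <= N%:E)%E by apply: le_trans hN'; rewrite leeDr.
apply: (le_trans (integral_exp_step p tp n.+1)); rewrite EFinM lee_wpmul2l//.
  by rewrite lee_fin; apply: addr_ge0; apply: mulr_ge0 => //; exact: sqr_ge0.
rewrite EFinD !EFinM; apply: leeD; first exact: lee_pmul.
have h : (A p n.+2 setT <= (N + B)%:E)%E.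
  by apply: (le_trans (integral_exp_interpolation p tp n)); rewrite EFinD; exact: leeD.
exact: lee_pmul.
Qed.

End test_function_bounds.

(** * Passage to the limit *)

Section real_inequalities.
Context {R : realType}.

(** The truncation of [a] is at most [|b| + d], where [d] is the truncation of [|a - b|]. All but
    two of the factors of [d] are bounded by [L], leaving a quadratic error. The power of 2 comes
    from bounding the sum by twice the larger term. *)
Lemma min_norm_exp_le (a b L : R) k : 0 <= L ->
  Num.min `|a| L ^+ k.+2 <= 2 ^+ k.+2 * (`|b| ^+ k.+2 + L ^+ k * (a - b) ^+ 2).
Proof.
move=> L0; set d := Num.min `|a - b| L.
have d0 : 0 <= d by rewrite /d le_min normr_ge0.
have dL : d <= L by rewrite /d ge_min lexx orbT.
have dab : d <= `|a - b| by rewrite /d ge_min lexx.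
have m0 : 0 <= Num.min `|a| L by rewrite le_min normr_ge0.
have le1 : Num.min `|a| L <= `|b| + d.
  rewrite /d; have [h|h] := leP `|a - b| L.
    by rewrite ge_min -{1}(subrK b a) addrC ler_normD.
  by rewrite ge_min lerDr normr_ge0 orbT.
have le2 : `|b| + d <= 2 * Num.max `|b| d.
  have h1 : `|b| <= Num.max `|b| d by rewrite le_max lexx.
  have h2 : d <= Num.max `|b| d by rewrite le_max lexx orbT.
  lra.
have dk : d ^+ k.+2 <= L ^+ k * (a - b) ^+ 2.
  rewrite -addn2 exprD -(real_normK (num_real (a - b))).
  by apply: ler_pM; rewrite ?exprn_ge0//; apply: lerXn2r; rewrite ?nnegrE.
apply: (@le_trans _ _ ((2 * Num.max `|b| d) ^+ k.+2)).
  have mx0 : 0 <= 2 * Num.max `|b| d by rewrite mulr_ge0// le_max normr_ge0.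
  by rewrite ler_pXn2r// ?nnegrE// (le_trans le1).
rewrite exprMn ler_pM2l ?exprn_gt0//.
have [h|h] := leP `|b| d.
  by rewrite (le_trans dk)// lerDr exprn_ge0.
by rewrite lerDl mulr_ge0 ?sqr_ge0 ?exprn_ge0.
Qed.

(** Near [0] the power [tau] is negligible against the square, and at infinity against the power
    [2m]. On the compact range in between, any positive function dominates it up to a constant, so
    [t ^+ 4] serves whether [tau] is below or above 4. *)
Lemma powR_interpolation (tau d : R) (m : nat) : 2 < tau -> tau < (m * 2)%:R ->
  0 < d -> exists2 K : R, 0 <= K & forall t : R, 0 <= t ->
    t `^ tau <= d * (t ^+ 2 + t ^+ (m * 2)) + K * t ^+ 4.
Proof.
move=> tau2 taum d0.
have tau0 : 0 < tau by rewrite (lt_trans _ tau2).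
have tm0 : 0 < (m * 2)%:R - tau by rewrite subr_gt0.
have t20 : 0 < tau - 2 by rewrite subr_gt0.
(* The thresholds solve [t0^(tau - 2) = d] and [T^(2m - tau) = 1/d], the points where the two outer
   comparisons become valid. *)
pose t0 : R := d `^ (tau - 2)^-1.
pose T : R := d^-1 `^ ((m * 2)%:R - tau)^-1.
have t00 : 0 < t0 by rewrite powR_gt0.
have T0 : 0 < T by rewrite powR_gt0// invr_gt0.
have t0E : t0 `^ (tau - 2) = d by rewrite -powRrM mulVf ?gt_eqF// powRr1// ltW.
have TE : T `^ ((m * 2)%:R - tau) = d^-1.
  by rewrite -powRrM mulVf ?gt_eqF// powRr1// invr_ge0 ltW.
exists (T `^ tau / t0 ^+ 4); first by rewrite divr_ge0 ?powR_ge0// exprn_ge0// ltW.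
move=> t tge0.
have [->|tn0] := eqVneq t 0.
  by rewrite powR0 ?gt_eqF// addr_ge0// mulr_ge0 ?addr_ge0 ?exprn_ge0// ?divr_ge0 ?powR_ge0 ?exprn_ge0// ltW.
have tgt0 : 0 < t by rewrite lt_neqAle eq_sym tn0.
have K0 : 0 <= T `^ tau / t0 ^+ 4 * t ^+ 4.
  by rewrite mulr_ge0 ?divr_ge0 ?powR_ge0// exprn_ge0// ltW.
have [tt0|t0t] := leP t t0.
  have -> : t `^ tau = t ^+ 2 * t `^ (tau - 2).
    by rewrite -powR_mulrn// -powRD ?tn0 ?implybT// addrC subrK.
  have h : t `^ (tau - 2) <= d.
    by rewrite -t0E ge0_ler_powR ?nnegrE// ltW.
  have h2 : t ^+ 2 * t `^ (tau - 2) <= t ^+ 2 * d by rewrite ler_wpM2l// sqr_ge0.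
  have h3 : 0 <= d * t ^+ (m * 2) by rewrite mulr_ge0 ?exprn_ge0// ltW.
  by rewrite (le_trans h2)// mulrDr -addrA mulrC lerDl addr_ge0.
have [Tt|tT] := leP T t.
  have h : t `^ tau * t `^ ((m * 2)%:R - tau) = t ^+ (m * 2).
    by rewrite -powRD ?tn0 ?implybT// addrC subrK powR_mulrn.
  have h1 : d^-1 <= t `^ ((m * 2)%:R - tau).
    by rewrite -TE ge0_ler_powR ?nnegrE// ltW.
  have h2 : t `^ tau <= d * t ^+ (m * 2).
    by rewrite -h mulrC -ler_pdivrMr// ler_wpM2l ?powR_ge0.
  have h3 : 0 <= d * t ^+ 2 by rewrite mulr_ge0 ?exprn_ge0// ltW.
  by rewrite (le_trans h2)// mulrDr addrAC lerDr addr_ge0.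
apply: (@le_trans _ _ (T `^ tau / t0 ^+ 4 * t ^+ 4)); last first.
  by rewrite lerDr mulr_ge0 ?addr_ge0 ?exprn_ge0// ltW.
rewrite mulrAC -mulrA (@le_trans _ _ (T `^ tau))//.
  by rewrite ge0_ler_powR ?nnegrE// ltW.
rewrite ler_peMr ?powR_ge0// ler_pdivlMr ?exprn_gt0// mul1r.
by rewrite ler_pXn2r ?nnegrE// ltW.
Qed.

End real_inequalities.

Lemma measurable_funZ (d : measure_display) (T : measurableType d) (R : realType) (D : set T)
  (k : R) (f : T -> R) :
  measurable_fun D f -> measurable_fun D (fun z => k * f z).
Proof. by move=> mf; apply: measurable_funM => //; exact: measurable_cst. Qed.
Arguments measurable_funZ {d T R D} k {f}.

(** * Truncation and approximation by test functions *)

Section limit.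
Context {R : realType}.
Variable V : pt R -> R.
Hypothesis mV : measurable_fun [set: pt R] V.
Hypothesis V0 : forall z, 0 < V z.

(** Monotone convergence along integer heights; at each point the truncation is eventually
    inactive. *)
Lemma integral_truncation_le (u : pt R -> R) k (B : R) :
  measurable_fun [set: pt R] u ->
  (forall n : nat, (\int[@mu2 R]_z (V z * Num.min `|u z| n%:R ^+ k)%:E <= B%:E)%E) ->
  (\int[@mu2 R]_z (V z * `|u z| ^+ k)%:E <= B%:E)%E.
Proof.
move=> mu h.
pose g (n : nat) z := (V z * Num.min `|u z| n%:R ^+ k)%:E.
have m0 z n : 0 <= Num.min `|u z| n%:R by rewrite le_min normr_ge0 ler0n.
have mg n : measurable_fun [set: pt R] (g n).
  apply/measurable_EFinP; apply: measurable_funM => //; apply: measurable_funX.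
  by apply: measurable_minr => //; exact: measurableT_comp.
have g0 n z : [set: pt R] z -> (0 <= g n z)%E.
  by move=> _; rewrite lee_fin mulr_ge0 ?exprn_ge0// ltW.
have ndg z : [set: pt R] z -> nondecreasing_seq (g ^~ z).
  move=> _ n n' nn'; rewrite lee_fin ler_pM2l//.
  rewrite lerXn2r ?nnegrE// le_min ge_min lexx/= ge_min.
  by rewrite ler_nat nn' orbT.
have := @cvg_monotone_convergence _ _ _ (@mu2 R) _ measurableT g mg g0 ndg.
have -> : (\int[@mu2 R]_z limn (g ^~ z) = \int[@mu2 R]_z (V z * `|u z| ^+ k)%:E)%E.
  apply: eq_integral => z _; apply/cvg_lim => //.
  apply: cvg_near_cst.
  exists (Num.Def.archi_bound `|u z|) => //= n /= hn; rewrite /g.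
  congr (_ * _ ^+ _)%:E; apply/min_idPl.
  by rewrite (le_trans (ltW (archi_boundP (normr_ge0 _))))// ler_nat.
move=> hc.
rewrite -(cvg_lim _ hc)//; apply: lime_le; first by apply: cvgP hc.
by near=> n; exact: h.
Unshelve. all: by end_near. Qed.

Section one_function.
Variables (u g1 g2 : pt R -> R).
Hypothesis uH : in_H1V V u g1 g2.

Let mu_ : measurable_fun [set: pt R] u. Proof. by case: uH => -[[]]. Qed.
Let mg1 : measurable_fun [set: pt R] g1. Proof. by case: uH => -[_ []]. Qed.
Let mg2 : measurable_fun [set: pt R] g2. Proof. by case: uH => -[_ _ []]. Qed.

Let dist (p : pt R -> R) := normV2 V (fun x => u x - p x)
  (fun x => g1 x - dx p x) (fun x => g2 x - dy p x).

Section approximant.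
Variable p : pt R -> R.
Hypothesis p_test : test_fun p.

Let mp : measurable_fun [set: pt R] p.
Proof. by apply: continuous_measurable_fun2; case: p_test => h _; exact: (h 0). Qed.
Let mpx : measurable_fun [set: pt R] (dx p).
Proof. by case: p_test => h _; case: (h 1) => _ [cp _]; exact: (continuous_measurable_fun2 _ cp). Qed.
Let mpy : measurable_fun [set: pt R] (dy p).
Proof. by case: p_test => h _; case: (h 1) => _ [_ cp]; exact: (continuous_measurable_fun2 _ cp). Qed.

Let mnorm (v h1 h2 : pt R -> R) : measurable_fun [set: pt R] v ->
  measurable_fun [set: pt R] h1 -> measurable_fun [set: pt R] h2 ->
  measurable_fun [set: pt R] (fun x => h1 x ^+ 2 + h2 x ^+ 2 + V x * v x ^+ 2).
Proof.
move=> m1 m2 m3; apply: measurable_funD; last first.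
  by apply: measurable_funM => //; exact: measurable_funX.
by apply: measurable_funD; exact: measurable_funX.
Qed.

Let mdist : measurable_fun [set: pt R] (fun x => (g1 x - dx p x) ^+ 2 +
  (g2 x - dy p x) ^+ 2 + V x * (u x - p x) ^+ 2).
Proof. by apply: mnorm; exact: measurable_funB. Qed.

Let Vsq_ge0 (v : pt R -> R) z : 0 <= V z * v z ^+ 2.
Proof. by rewrite mulr_ge0 ?sqr_ge0// ltW. Qed.

Let norm_ge0 (v h1 h2 : pt R -> R) z :
  0 <= h1 z ^+ 2 + h2 z ^+ 2 + V z * v z ^+ 2.
Proof. by rewrite addr_ge0 ?addr_ge0 ?sqr_ge0. Qed.

Let mVup : measurable_fun [set: pt R] (fun x => V x * (u x - p x) ^+ 2).
Proof. by apply: measurable_funM => //; apply: measurable_funX; exact: measurable_funB. Qed.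

Lemma integral_diff_le : (\int[@mu2 R]_z (V z * (u z - p z) ^+ 2)%:E <= dist p)%E.
Proof.
apply: (le_integral_real (@mu2 R) setT _ _ measurableT mVup mdist) => z _.
  exact: (Vsq_ge0 (fun z => u z - p z)).
by rewrite lerDr addr_ge0 ?sqr_ge0.
Qed.

Lemma normV2_approximant_le :
  (normV2 V p (dx p) (dy p) <= 2%:E * normV2 V u g1 g2 + 2%:E * dist p)%E.
Proof.
rewrite /dist /normV2.
rewrite -(integral_realZ (@mu2 R) setT 2 _ measurableT (mnorm _ _ _ mu_ mg1 mg2))//.
rewrite -(integral_realZ (@mu2 R) setT 2 _ measurableT mdist)//; last first.
  by move=> z _; exact: (norm_ge0 (fun z => u z - p z) (fun z => g1 z - dx p z) (fun z => g2 z - dy p z)).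
rewrite -(integral_realD (@mu2 R) setT _ _ measurableT
   (measurable_funZ 2 (mnorm _ _ _ mu_ mg1 mg2))
   (measurable_funZ 2 mdist))//=; last 2 first.
- by move=> z _; rewrite mulr_ge0.
- move=> z _; rewrite mulr_ge0//.
  exact: (norm_ge0 (fun z => u z - p z) (fun z => g1 z - dx p z) (fun z => g2 z - dy p z)).
apply: (le_integral_real (@mu2 R) setT _ _ measurableT (mnorm _ _ _ mp mpx mpy)
  (measurable_funD (measurable_funZ 2 (mnorm _ _ _ mu_ mg1 mg2))
   (measurable_funZ 2 mdist))) => //= z _.
have sq (a b : R) : b ^+ 2 <= 2 * a ^+ 2 + 2 * (a - b) ^+ 2.
  by have := sqr_ge0 (2 * a - b); nra.
have h1 := sq (g1 z) (dx p z); have h2 := sq (g2 z) (dy p z).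
have h3 : V z * p z ^+ 2 <= V z * (2 * u z ^+ 2 + 2 * (u z - p z) ^+ 2).
  by rewrite ler_pM2l.
lra.
Qed.

Lemma integral_ball_approximant_le D : measurable D ->
  (\int[@mu2 R]_(z in D) (V z * p z ^+ 2)%:E <=
   2%:E * \int[@mu2 R]_(z in D) (V z * u z ^+ 2)%:E + 2%:E * dist p)%E.
Proof.
move=> mD.
have mVu : measurable_fun D (fun x => V x * u x ^+ 2).
  by apply: measurable_funTS; apply: measurable_funM => //; exact: measurable_funX.
have mVp : measurable_fun D (fun x => V x * p x ^+ 2).
  by apply: measurable_funTS; apply: measurable_funM => //; exact: measurable_funX.
have mVupD : measurable_fun D (fun x => V x * (u x - p x) ^+ 2).
  exact: (measurable_funTS mVup).
apply: (@le_trans _ _ (2%:E * \int[@mu2 R]_(z in D) (V z * u z ^+ 2)%:E +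
  2%:E * \int[@mu2 R]_(z in D) (V z * (u z - p z) ^+ 2)%:E)%E); last first.
  rewrite leeD2l// lee_wpmul2l// (le_trans _ integral_diff_le)//.
  have mE : measurable_fun [set: pt R] (fun z => (V z * (u z - p z) ^+ 2)%:E).
    by apply/measurable_EFinP.
  apply: (@ge0_subset_integral _ _ _ (@mu2 R) _ _ mD measurableT _ mE) => // z _.
  by rewrite lee_fin; exact: (Vsq_ge0 (fun z => u z - p z)).
rewrite -(integral_realZ (@mu2 R) D 2 _ mD mVu)//.
rewrite -(integral_realZ (@mu2 R) D 2 _ mD mVupD)//; last first.
  by move=> z _; exact: (Vsq_ge0 (fun z => u z - p z)).
rewrite -(integral_realD (@mu2 R) D _ _ mD
   (measurable_funZ 2 mVu)
   (measurable_funZ 2 mVupD))//=; last 2 first.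
- by move=> z _; rewrite mulr_ge0.
- by move=> z _; rewrite mulr_ge0//; exact: (Vsq_ge0 (fun z => u z - p z)).
apply: (le_integral_real (@mu2 R) D _ _ mD mVp
  (measurable_funD (measurable_funZ 2 mVu)
   (measurable_funZ 2 mVupD))) => //= z _.
have sq (a b : R) : b ^+ 2 <= 2 * a ^+ 2 + 2 * (a - b) ^+ 2.
  by have := sqr_ge0 (2 * a - b); nra.
have h3 : V z * p z ^+ 2 <= V z * (2 * u z ^+ 2 + 2 * (u z - p z) ^+ 2).
  by rewrite ler_pM2l.
lra.
Qed.

Lemma truncation_approximant_le k (B e : R) (n : nat) :
  (\int[@mu2 R]_z (V z * `|p z| ^+ k.+2)%:E <= B%:E)%E -> (dist p <= e%:E)%E ->
  (\int[@mu2 R]_z (V z * Num.min `|u z| n%:R ^+ k.+2)%:E <=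
   (2 ^+ k.+2 * (B + n%:R ^+ k * e))%:E)%E.
Proof.
move=> hB he.
have mVpk : measurable_fun [set: pt R] (fun z => V z * `|p z| ^+ k.+2).
  by apply: measurable_funM => //; apply: measurable_funX; exact: measurableT_comp.
have mc : measurable_fun [set: pt R] (fun z => n%:R ^+ k * (V z * (u z - p z) ^+ 2)).
  exact: (measurable_funZ _ mVup).
have ms := measurable_funD mVpk mc.
have n0 : 0 <= n%:R ^+ k :> R by rewrite exprn_ge0.
have c0 z : 0 <= n%:R ^+ k * (V z * (u z - p z) ^+ 2).
  by rewrite mulr_ge0//; exact: (Vsq_ge0 (fun z => u z - p z)).
have d0 z : 0 <= V z * `|p z| ^+ k.+2 by rewrite mulr_ge0 ?exprn_ge0// ltW.
apply: (@le_trans _ _ (\int[@mu2 R]_z (2 ^+ k.+2 *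
   (V z * `|p z| ^+ k.+2 + n%:R ^+ k * (V z * (u z - p z) ^+ 2)))%:E)%E).
  apply: le_integral_real => //.
  - apply: measurable_funM => //; apply: measurable_funX.
    by apply: measurable_minr => //; exact: measurableT_comp.
  - exact: (measurable_funZ _ ms).
  - by move=> z _; rewrite mulr_ge0 ?exprn_ge0 ?le_min ?normr_ge0 ?ler0n// ltW.
  - move=> z _; have := min_norm_exp_le (u z) (p z) n%:R k (ler0n _ n).
    rewrite -(ler_pM2l (V0 z)) => /le_trans; apply.
    by rewrite le_eqVlt; apply/orP; left; apply/eqP; ring.
rewrite integral_realZ//; last by move=> z _; rewrite addr_ge0.
rewrite [leRHS]EFinM lee_wpmul2l ?lee_fin ?exprn_ge0//.
rewrite (integral_realD (@mu2 R) setT _ _ measurableT mVpk mc)// EFinD; apply: leeD => //.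
rewrite (integral_realZ (@mu2 R) setT _ _ measurableT mVup)//; last first.
  by move=> z _; exact: (Vsq_ge0 (fun z => u z - p z)).
by rewrite [leRHS]EFinM lee_wpmul2l ?lee_fin// (le_trans integral_diff_le).
Qed.

End approximant.

(** For each height an approximant is chosen so close that the error stays below [d], uniformly in
    the height, which then tends to infinity. The assumption concerns only test functions within [e]
    of [u], where their norms and ball integrals are under control. *)
Lemma integral_exp_le k (B e d : R) : 0 < e -> 0 < d ->
  (forall p, test_fun p -> (dist p <= e%:E)%E ->
    (\int[@mu2 R]_z (V z * `|p z| ^+ k.+2)%:E <= B%:E)%E) ->
  (\int[@mu2 R]_z (V z * `|u z| ^+ k.+2)%:E <= (2 ^+ k.+2 * (B + d))%:E)%E.
Proof.
move=> e0 d0 hB; apply: integral_truncation_le => // n.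
have n1 : 0 < n%:R ^+ k + 1 :> R by rewrite ltr_wpDl// exprn_ge0.
(* The [+ 1] keeps the denominator positive at height [0]. *)
pose h := Num.min e (d / (n%:R ^+ k + 1)).
have h0 : 0 < h by rewrite lt_min e0 divr_gt0.
have [_ [phi [tphi cphi]]] := uH.
have [i hi] : exists i, (dist (phi i) <= h%:E)%E.
  move/fine_cvgP : cphi => [fin /cvgrPdist_le /(_ h h0) hc].
  have [i [fi hci]] := filter_ex (filterI fin hc).
  exists i; rewrite /dist -[leLHS]fineK// lee_fin.
  by move: hci; rewrite sub0r normrN; apply: le_trans; exact: ler_norm.
have he : (dist (phi i) <= e%:E)%E.
  by apply: (le_trans hi); rewrite lee_fin ge_min lexx.
apply: (le_trans (truncation_approximant_le _ (tphi i) k B h n (hB _ (tphi i) he) hi)).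
rewrite lee_fin ler_pM2l ?exprn_gt0// lerD2l.
have hd : h <= d / (n%:R ^+ k + 1) by rewrite ge_min lexx orbT.
apply: (@le_trans _ _ ((n%:R ^+ k + 1) * h)).
  by rewrite ler_pM2r// lerDl.
by rewrite mulrC -ler_pdivlMr.
Qed.

End one_function.
End limit.

Lemma cvge0_le (R : realType) (f : nat -> \bar R) :
  (forall n, (0 <= f n)%E) ->
  (forall e : R, 0 < e -> \forall n \near \oo, (f n <= e%:E)%E) ->
  f @ \oo --> 0%E.
Proof.
move=> f0 h; apply/fine_cvgP; split.
  have := h 1 ltr01; apply: filterS => n fn.
  by rewrite ge0_fin_numE// (le_lt_trans fn)// ltry.
apply/cvgrPdist_le => e e0; have := h e e0; apply: filterS => n fn.
rewrite sub0r normrN /= ger0_norm ?fine_ge0//.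
by rewrite -lee_fin fineK// ge0_fin_numE// (le_lt_trans fn)// ltry.
Qed.

(** * Interpolation between a vanishing power and bounded ones *)

Theorem lemma3p6 (R : realType) (V : pt R -> R)
  (V_cont : continuous V)
  (V_inf : exists c : R, 0 < c /\ forall x, c <= V x)
  (V_grad : exists (G1 G2 : pt R -> R) (C : R), weak_grad V G1 G2 /\ 0 < C /\
     {ae @mu2 R, forall x, Num.sqrt (G1 x ^+ 2 + G2 x ^+ 2) <= C * V x `^ (3 / 2)})
  (u g1 g2 : nat -> pt R -> R)
  (u_H1V : forall n, in_H1V V (u n) (g1 n) (g2 n))
  (u_bdd : exists M : R, forall n, (normV2 V (u n) (g1 n) (g2 n) <= M%:E)%E)
  (r : R) (r_pos : 0 < r)
  (vanish : (fun n => ereal_sup (range (fun xi : pt R =>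
               (\int[@mu2 R]_(x in ball2 xi r) (V x * u n x ^+ 2)%:E)%E)))
            @ \oo --> 0%E) :
  forall tau : R, 2 < tau ->
    (fun n => (\int[@mu2 R]_x (V x * `|u n x| `^ tau)%:E)%E) @ \oo --> 0%E.
Proof.
move=> tau tau2.
have [c [c0 V_ge]] := V_inf.
have [G1 [G2 [C [wV [C0 GC]]]]] := V_grad.
have [M uM] := u_bdd.
have V0 z : 0 < V z by exact: lt_le_trans (V_ge z).
have mV : measurable_fun [set: pt R] V by exact: continuous_measurable_fun2.
have mu n : measurable_fun [set: pt R] (u n) by case: (u_H1V n) => -[[]].
have Vfst := increment_fst V G1 G2 C c V_cont c0 V_ge C0 wV GC.
have Vsnd := increment_snd V G1 G2 C c V_cont c0 V_ge C0 wV GC.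
have nV0 (v h1 h2 : pt R -> R) : (0 <= normV2 V v h1 h2)%E.
  apply: integral_ge0 => z _; rewrite lee_fin.
  by rewrite !addr_ge0 ?sqr_ge0// mulr_ge0 ?sqr_ge0// ltW.
have M0 : 0 <= M by rewrite -lee_fin (le_trans (nV0 _ _ _) (uM 0%N)).
(* Bounds the squared norm of any test function at squared distance at most 1 from some [u n], by
   [b^2 <= 2 a^2 + 2 (a - b)^2]. *)
pose N := 2 * M + 2.
have N0 : 0 < N by rewrite ltr_wpDl// mulr_ge0.
pose dist n (p : pt R -> R) := normV2 V (fun x => u n x - p x)
  (fun x => g1 n x - dx p x) (fun x => g2 n x - dy p x).
have normN n p : test_fun p -> (dist n p <= 1%:E)%E ->
    (normV2 V p (dx p) (dy p) <= N%:E)%E.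
  move=> tp d1; apply: (le_trans (normV2_approximant_le V mV V0 _ _ _ (u_H1V n) p tp)).
  have -> : (N%:E = 2%:E * M%:E + 2%:E)%E by [].
  apply: leeD; first by rewrite lee_wpmul2l.
  by rewrite -[X in (_ <= X)%E]mule1 lee_wpmul2l.
have A2 n : (\int[@mu2 R]_z (V z * `|u n z| ^+ 2)%:E <= M%:E)%E.
  have mun := mu n; apply: le_trans (uM n); apply: le_integral_real => //.
  - by apply: measurable_funM => //; apply: measurable_funX; exact: measurableT_comp.
  - have [[_ [m1 _] [m2 _] _] _] := u_H1V n.
    apply: measurable_funD; first by apply: measurable_funD; exact: measurable_funX.
    by apply: measurable_funM => //; exact: measurable_funX.
  - by move=> z _; rewrite mulr_ge0 ?exprn_ge0// ltW.
  - by move=> z _; rewrite real_normK ?num_real// lerDr addr_ge0 ?sqr_ge0.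
(* Any [m] with [2m > tau] would do; the successor matches the exponent [n.+1 * 2] of
   [integral_exp_bounded]. *)
pose m := (Num.Def.archi_bound tau).+1.
have taum : tau < (m * 2)%:R.
  rewrite (lt_le_trans (archi_boundP _))//; first by rewrite ltW// (lt_trans _ tau2).
  by rewrite ler_nat /m muln2 -addnn (leq_trans (leqnSn _))// leq_addr.
have [B hB] := integral_exp_bounded V C c r V_cont c0 V_ge C0 r_pos Vfst Vsnd (Num.Def.archi_bound tau) N.
rewrite -/m in hB.
have m2 : (m * 2 = (m * 2 - 2).+2)%N.
  by rewrite -[RHS]addn2 subnK// /m mulSn leq_addr.
(* [B] comes without a sign; the maximum with [0] supplies one. *)
pose B' := Num.max (2 ^+ (m * 2) * (B + 1)) 0.
have B'0 : 0 <= B' by rewrite le_max lexx orbT.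
have Am n : (\int[@mu2 R]_z (V z * `|u n z| ^+ (m * 2))%:E <= B'%:E)%E.
  apply: (@le_trans _ _ (2 ^+ (m * 2) * (B + 1))%:E); last by rewrite lee_fin le_max lexx.
  rewrite m2; apply: (integral_exp_le V mV V0 _ _ _ (u_H1V n) _ B 1 1) => // p tp d1.
  by rewrite -m2; apply: hB => //; exact: (normN n).
pose K : R := 4 * 2%:R ^+ 2 + 2 * (C / 2 + r^-1 / Num.sqrt c) ^+ 2.
have K0 : 0 <= K by apply: addr_ge0; apply: mulr_ge0 => //; exact: sqr_ge0.
(* The [4] is [2 + 2], from the ball integrals of an approximant; the [1] is the slack [e] of
   [integral_exp_le], and [2 ^+ 4] its truncation factor. *)
pose K' := 2 ^+ 4 * (K * (4 * N) + 1).
have K'0 : 0 < K'.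
  by rewrite mulr_gt0 ?exprn_gt0// ltr_wpDl// !mulr_ge0// ltW.
have A4 e : 0 < e -> \forall n \near \oo,
    (\int[@mu2 R]_z (V z * `|u n z| ^+ 4)%:E <= (K' * e)%:E)%E.
  move=> e0; move/fine_cvgP : vanish => [fin /cvgrPdist_le /(_ e e0) hc].
  near=> n.
  have un xi : (\int[@mu2 R]_(x in ball2 xi r) (V x * u n x ^+ 2)%:E <= e%:E)%E.
    apply: (@le_trans _ _ (ereal_sup (range (fun xi : pt R =>
               (\int[@mu2 R]_(x in ball2 xi r) (V x * u n x ^+ 2)%:E)%E)))).
      by apply: ereal_sup_ubound; exists xi.
    have fn : ereal_sup (range (fun xi : pt R =>
      (\int[@mu2 R]_(x in ball2 xi r) (V x * u n x ^+ 2)%:E)%E)) \is a fin_num.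
      by near: n.
    rewrite -[leLHS]fineK// lee_fin (le_trans (ler_norm _))//.
    by rewrite -normrN -sub0r; near: n.
  (* Distance at most 1 keeps the norm below [N]; distance at most [e] keeps the ball integrals of
     the approximant below [4 e]. *)
  have e10 : 0 < Num.min 1 e by rewrite lt_min ltr01.
  have -> : K' * e = 2 ^+ 4 * (K * (4 * e * N) + e) by rewrite /K'; ring.
  apply: (integral_exp_le V mV V0 _ _ _ (u_H1V n) 2 _ (Num.min 1 e) e) => // p tp d1.
  have d1' : (dist n p <= 1%:E)%E.
    by apply: (le_trans d1); rewrite lee_fin ge_min lexx.
  have de : (dist n p <= e%:E)%E.
    by apply: (le_trans d1); rewrite lee_fin ge_min lexx orbT.
  apply: (le_trans (integral_exp4_le V C c r V_cont c0 V_ge C0 r_pos Vfst Vsnd p tp (4 * e) _)).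
    move=> xi; apply: (le_trans (integral_ball_approximant_le V mV V0 _ _ _ (u_H1V n) p tp _ (measurable_ball2 xi r))).
    have -> : ((4 * e)%:E = 2%:E * e%:E + 2%:E * e%:E)%E.
      by rewrite -EFinM -EFinD; congr (_%:E); ring.
    by apply: leeD; rewrite lee_wpmul2l.
  rewrite -/K [leRHS]EFinM lee_wpmul2l ?lee_fin// [leRHS]EFinM lee_wpmul2l ?lee_fin//.
    by rewrite mulr_ge0// ltW.
  exact: (normN n).
apply: cvge0_le => [n|e e0].
  by apply: integral_ge0 => z _; rewrite lee_fin mulr_ge0 ?powR_ge0// ltW.
(* Half of [e] goes to the two bounded powers, which fixes [d] and with it [L]; only then is [n]
   taken large enough for [L] times the fourth power to fit in the other half. *)
pose d := e / (2 * (M + B' + 1)).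
have MB : 0 < M + B' + 1 by rewrite ltr_wpDl// addr_ge0.
have d0 : 0 < d by rewrite divr_gt0// mulr_gt0.
have [L L0 hL] := powR_interpolation tau d m tau2 taum d0.
have L1 : 0 < L + 1 by rewrite ltr_wpDl.
(* [L + 1] is used because [L] may be [0]. *)
have e'0 : 0 < e / (2 * (L + 1) * K') by rewrite divr_gt0// mulr_gt0// mulr_gt0.
near=> n.
have A4n : (\int[@mu2 R]_z (V z * `|u n z| ^+ 4)%:E <= (K' * (e / (2 * (L + 1) * K')))%:E)%E.
  by near: n; exact: A4.
have mun := mu n.
have mk k : measurable_fun [set: pt R] (fun z => V z * `|u n z| ^+ k).
  by apply: measurable_funM => //; apply: measurable_funX; exact: measurableT_comp.
have mnu : measurable_fun [set: pt R] (fun z => `|u n z|) by exact: measurableT_comp.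
have mpw : measurable_fun [set: pt R] (fun z => `|u n z| `^ tau).
  exact: (@measurableT_comp _ _ _ _ _ _ (fun x : R => x `^ tau) _ _ (measurable_powR tau) mnu).
have k0 k z : 0 <= V z * `|u n z| ^+ k by rewrite mulr_ge0 ?exprn_ge0// ltW.
have ms := measurable_funD (mk 2) (mk (m * 2)%N).
have mt := measurable_funD (measurable_funZ d ms) (measurable_funZ L (mk 4)).
apply: (@le_trans _ _ (\int[@mu2 R]_z (d * (V z * `|u n z| ^+ 2 +
   V z * `|u n z| ^+ (m * 2)) + L * (V z * `|u n z| ^+ 4))%:E)%E).
  apply: (le_integral_real (@mu2 R) setT _ _ measurableT _ mt) => [|z _|z _].
  - apply: measurable_funM => //; exact: mpw.
  - by rewrite mulr_ge0 ?powR_ge0// ltW.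
  - have := hL `|u n z| (normr_ge0 _); rewrite -(ler_pM2l (V0 z)) => /le_trans; apply.
    by rewrite le_eqVlt; apply/orP; left; apply/eqP => /=; ring.
rewrite (integral_realD (@mu2 R) setT _ _ measurableT (measurable_funZ d ms) (measurable_funZ L (mk 4)))//; last 2 first.
- by move=> z _; rewrite mulr_ge0 ?addr_ge0// ltW.
- by move=> z _; rewrite mulr_ge0.
rewrite (integral_realZ (@mu2 R) setT d _ measurableT ms)//; last 2 first.
- by move=> z _; rewrite addr_ge0.
- exact: ltW.
rewrite (integral_realZ (@mu2 R) setT L _ measurableT (mk 4%N))//.
rewrite (integral_realD (@mu2 R) setT _ _ measurableT (mk 2) (mk (m * 2)%N))//.
apply: (@le_trans _ _ (d%:E * (M%:E + B'%:E) + L%:E * (K' * (e / (2 * (L + 1) * K')))%:E)%E).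
  apply: leeD; last by rewrite lee_wpmul2l.
  by rewrite lee_wpmul2l ?lee_fin ?(ltW d0)//; apply: leeD.
rewrite -(EFinD M) -(EFinM d) -(EFinM L) -EFinD lee_fin.
have h1 : d * (M + B') <= e / 2.
  have -> : e / 2 = d * (M + B' + 1) by rewrite /d; field; rewrite gt_eqF.
  by rewrite ler_pM2l// lerDl.
have h2 : L * (K' * (e / (2 * (L + 1) * K'))) <= e / 2.
  have -> : L * (K' * (e / (2 * (L + 1) * K'))) = L / (L + 1) * (e / 2).
    by field; rewrite !gt_eqF.
  by rewrite ler_piMl ?divr_ge0 ?ltW// ltr_pdivrMr// mul1r ltrDl.
lra.
Unshelve. all: by end_near. Qed.
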